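(* Let $X, Y$ be finite dimensional Euclidean spaces, $A: X \to Y$ linear, $b \in Y$, $c \in X$, and $K \subseteq Y$ a nice closed convex cone. Consider the conic linear program $$(P)\qquad \sup\ \langle c, x\rangle \quad \text{s.t.}\quad b - Ax \in K,$$ assumed feasible, with minimal cone $F_{\min}$. Let $L = \{y \in Y : A^*y = 0,\ \langle b, y \rangle = 0\}$, let $\ell_K$ be the length of the longest chain of faces in $K$, and $\ell = \min\{\ell_K - 1, \dim L\}$. Let $(EXT_{\rm nice})$ be the system in the variables $(u_i, v_i)_{i=0}^{\ell+1}$, $u_i,v_i \in Y$: $$(u_0,v_0) = (0,0),\quad (u_i, v_i) \in K^* \times \tan(u_0 + \dots + u_{i-1}, K^* )\ (i = 1,\dots,\ell+1),\quad u_i + v_i \in L\ (i=1,\dots,\ell).$$ Then $$F_{\min}^* = \{\, u_{\ell+1} + v_{\ell+1} : (u_i,v_i)_{i=0}^{\ell+1} \text{ is feasible in } (EXT_{\rm nice}) \,\},$$ and the extended dual $$\inf\ \langle b, u_{\ell+1}+v_{\ell+1}\rangle \quad \text{s.t.}\quad A^*(u_{\ell+1}+v_{\ell+1}) = c,\ (u_i,v_i)_{i=0}^{\ell+1} \text{ is feasible in } (EXT_{\rm nice})$$ has strong duality with $(P)$. In particular, if $(P)$ is a semidefinite program with $m$ variables, independent constraint matrices $a_1,\dots,a_m$, and $K = \mathcal{S}^n_+$ (that is, $X = \mathbb{R}^m$, $Y = \mathcal{S}^n$, $Ax = \sum_{i=1}^m x_i a_i$ with $a_1, \dots, a_m \in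 \mathcal{S}^n$), then the problem $$\begin{array}{rll} \inf & \langle b, u_{\ell+1}+v_{\ell+1}\rangle & \\ \text{s.t.} & A^*(u_{\ell+1}+v_{\ell+1}) = c, & \\ & A^*(u_i+v_i) = 0,\ \langle b, u_i + v_i\rangle = 0, & i=1,\dots,\ell,\\ & u_i \succeq 0, & i=1,\dots,\ell+1,\\ & \begin{pmatrix} u_0+\dots+u_{i-1} & w_i \\ w_i^T & \beta_i I\end{pmatrix} \succeq 0, & i=1,\dots,\ell+1,\\ & v_i = w_i + w_i^T, & i=1,\dots,\ell+1,\\ & w_i \in \mathbb{R}^{n\times n},\ \beta_i \in \mathbb{R}, & i=1,\dots,\ell+1,\\ & (u_0,v_0) = (0,0), & \end{array}$$ where $\ell = \min\{ n,\ n(n+1)/2 - m - 1\}$, has strong duality with $(P)$.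
   Context: $\mathcal{S}^n$ is the space of $n\times n$ real symmetric matrices with inner product $\langle x, z\rangle = \sum_{i,j} x_{ij}z_{ij}$, $\mathcal{S}^n_+$ the cone of positive semidefinite ones, $y \succeq 0$ means $y$ is positive semidefinite. For a set $C$, $C^\perp$ is the orthogonal complement of its linear span. For a cone $C$, $C^* = \{ z : \langle z, x\rangle \ge 0 \ \forall x \in C\}$. $A^*$ is the adjoint of $A$. A convex subset $F$ of a convex set $C$ is a face of $C$ if $x_1, x_2 \in C$ and $(x_1,x_2)\cap F \ne \emptyset$ imply $x_1, x_2 \in F$, where $(x_1,x_2)$ is the open line segment. A closed convex cone $K$ is nice if $K^* + E^\perp$ is closed for all faces $E$ of $K$. For $x$ in a convex set $C$, $\operatorname{dir}(x,C) = \{ y : x + ty \in C \text{ for some } t>0\}$ and $\tan(x,C) = \operatorname{cl}\operatorname{dir}(x,C) \cap -\operatorname{cl}\operatorname{dir}(x,C)$. The minimal cone $F_{\min}$ of feasible $(P)$ is the unique face of $K$ that contains $b - A\bar{x}$ in its relative interior, where $\bar x$ is a point in the relative interior of the feasible set of $(P)$. The length of a chain of faces is the number of (nonempty) faces in a strictly increasing chain (e.g. $\ell_K = n+1$ for $\mathcal{S}^n_+$). A minimization problem $(D')$ has strong duality with the feasible problem $(P)$ if: $(P)$ is bounded if and only if $(D')$ is feasible; and when these equivalent conditions hold, the optimal values of $(P)$ and $(D')$ agree and the latter is attained.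
   Formalization: In the semidefinite part, ℓ = min{n, n(n+1)/2 − m − 1} is kept when b is not in the span of a_1,…,a_m; when b lies in that span, where the printed formula can fail, ℓ = min{n, n(n+1)/2 − m} is used instead. *)

(* Defs.v *)
From mathcomp Require Import all_boot all_order all_algebra.
From mathcomp Require Import boolp classical_sets functions reals ereal.
From mathcomp Require Import interval_inference convex.

Set Implicit Arguments.
Unset Strict Implicit.
Unset Printing Implicit Defensive.

Import Order.TTheory GRing.Theory Num.Theory.

Local Open Scope classical_set_scope.
Local Open Scope ring_scope.

(* A finite dimensional Euclidean space is a [vectType R] together with a
   positive definite symmetric bilinear form [ip : {dot V for idfun}]; its
   topology is the one of the norm sqrt <x, x>. *)
Section Euclidean.
Context {R : realType} {V : vectType R}.
Variable ip : {dot V for idfun}.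
Implicit Types (x y z : V) (C E F K : set V).

Definition enorm x : R := Num.sqrt (ip x x).

Definition eclosure C : set V :=
  [set x | forall e : R, 0 < e -> exists2 y, C y & enorm (x - y) < e].

Definition eclosed C : Prop := eclosure C `<=` C.

Definition lin_span C : set V :=
  [set x | exists (k : nat) (t : 'I_k -> R) (p : 'I_k -> V),
     (forall i, C (p i)) /\ x = \sum_i t i *: p i].

Definition aff_hull C : set V :=
  [set x | exists (k : nat) (t : 'I_k -> R) (p : 'I_k -> V),
     [/\ forall i, C (p i), \sum_i t i = 1 & x = \sum_i t i *: p i]].

Definition relint C : set V :=
  [set x | C x /\ exists2 e : R, 0 < e &
     forall y, aff_hull C y -> enorm (y - x) < e -> C y].

Definition perp C : set V := [set z | forall x, lin_span C x -> ip z x = 0].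

Definition dual_cone C : set V := [set z | forall x, C x -> 0 <= ip z x].

Definition is_cone C : Prop := forall x (t : R), 0 <= t -> C x -> C (t *: x).

Definition open_segment x y : set V :=
  [set z | exists2 t : R, 0 < t < 1 & z = (1 - t) *: x + t *: y].

(* The empty set is a face under this definition. *)
Definition is_face C F : Prop :=
  [/\ @convex_set R V F, F `<=` C &
      forall x1 x2, C x1 -> C x2 -> (open_segment x1 x2 `&` F) !=set0 ->
        F x1 /\ F x2].

Definition minkowski_sum C E : set V := [set x + y | x in C & y in E].

Definition is_nice K : Prop :=
  forall E, is_face K E -> eclosed (minkowski_sum (dual_cone K) (perp E)).

Definition feasible_dir x C : set V :=
  [set y | exists2 t : R, 0 < t & C (x + t *: y)].

Definition tan_space x C : set V :=
  [set y | eclosure (feasible_dir x C) y /\ eclosure (feasible_dir x C) (- y)].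

Definition face_chain C (k : nat) (G : nat -> set V) : Prop :=
  (forall i, (i < k)%N -> is_face C (G i) /\ G i !=set0) /\
  (forall i j, (i < j)%N -> (j < k)%N -> G i `<` G j).

(* Chains of faces in finite dimension have bounded length, so the default
   value 0 is never used when C is convex and nonempty. *)
Definition longest_chain C : nat :=
  xget 0%N [set k | (exists G, face_chain C k G) /\
    forall k', (exists G, face_chain C k' G) -> (k' <= k)%N].

End Euclidean.

Section Optimization.
Context {R : realType}.

Definition sup_value (T : Type) (S : set T) (f : T -> R) : \bar R :=
  ereal_sup [set (f x)%:E | x in S].

Definition inf_value (T : Type) (S : set T) (f : T -> R) : \bar R :=
  ereal_inf [set (f x)%:E | x in S].

(* [sup f over S] is a feasible maximization problem, [inf g over D] the
   candidate dual. *)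
Definition strong_duality (T U : Type)
    (S : set T) (f : T -> R) (D : set U) (g : U -> R) : Prop :=
  (has_ubound [set f x | x in S] <-> D !=set0) /\
  (has_ubound [set f x | x in S] -> D !=set0 ->
     sup_value S f = inf_value D g /\
     exists2 z, D z & (g z)%:E = inf_value D g).

End Optimization.

Section ConicProgram.
Context {R : realType} {X Y : vectType R}.
Variables (ipX : {dot X for idfun}) (ipY : {dot Y for idfun}).

Definition adjoint (A : {linear X -> Y}) (y : Y) : X :=
  xget 0 [set z | forall x, ipY (A x) y = ipX x z].

Definition primal_feasible (A : {linear X -> Y}) (b : Y) (K : set Y) : set X :=
  [set x | K (b - A x)].

Definition min_cone (A : {linear X -> Y}) (b : Y) (K : set Y) : set Y :=
  xget set0 [set F | is_face K F /\
    exists2 xbar, relint ipX (primal_feasible A b K) xbar &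
      relint ipY F (b - A xbar)].

End ConicProgram.

(* The family (u_i, v_i), i = 0, ..., ell+1, is indexed by 'I_ell.+2, so that
   the index ell+1 is ord_max. *)
Definition ext_var (R : realType) (Y : vectType R) (ell : nat) : Type :=
  ('I_ell.+2 -> Y) * ('I_ell.+2 -> Y).

Definition ext_last (R : realType) (Y : vectType R) (ell : nat)
    (uv : ext_var Y ell) : Y :=
  uv.1 ord_max + uv.2 ord_max.

Definition ext_nice (R : realType) (Y : vectType R) (ip : {dot Y for idfun})
    (K : set Y) (L : {vspace Y}) (ell : nat) : set (ext_var Y ell) :=
  [set uv | let: (u, v) := uv in
    [/\ u ord0 = 0 /\ v ord0 = 0,
        forall i : 'I_ell.+2, (0 < i)%N ->
          dual_cone ip K (u i) /\
          tan_space ip (\sum_(j < ell.+2 | (j < i)%N) u j) (dual_cone ip K) (v i) &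
        forall i : 'I_ell.+2, (0 < i <= ell)%N -> u i + v i \in L]].

Section Semidefinite.
Context {R : realType}.

Definition psd (k : nat) (M : 'M[R]_k) : Prop :=
  M^T = M /\ forall x : 'cV[R]_k, 0 <= (x^T *m M *m x) 0 0.

Definition mx_ip (n : nat) (x z : 'M[R]_n) : R := \sum_i \sum_j x i j * z i j.

Definition sdp_map (m n : nat) (a : 'I_m -> 'M[R]_n) (x : 'cV[R]_m) : 'M[R]_n :=
  \sum_i x i 0 *: a i.

Definition sdp_adjoint (m n : nat) (a : 'I_m -> 'M[R]_n) (y : 'M[R]_n) :
    'cV[R]_m :=
  \col_i mx_ip (a i) y.

Definition sdp_primal_feasible (m n : nat) (a : 'I_m -> 'M[R]_n)
    (b : 'M[R]_n) : set 'cV[R]_m :=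
  [set x | psd (b - sdp_map a x)].

(* All families are indexed by 0, ..., ell+1; the values of w and beta at index
   0 are unconstrained and play no role. *)
Record sdp_ext_var (n ell : nat) : Type := SdpExtVar {
  ext_u : 'I_ell.+2 -> 'M[R]_n;
  ext_v : 'I_ell.+2 -> 'M[R]_n;
  ext_w : 'I_ell.+2 -> 'M[R]_n;
  ext_beta : 'I_ell.+2 -> R }.

Definition sdp_ext_feasible (m n : nat) (a : 'I_m -> 'M[R]_n) (b : 'M[R]_n)
    (c : 'cV[R]_m) (ell : nat) : set (sdp_ext_var n ell) :=
  [set z | let: SdpExtVar u v w beta := z in
    [/\ sdp_adjoint a (u ord_max + v ord_max) = c,
        forall i : 'I_ell.+2, (0 < i <= ell)%N ->
          sdp_adjoint a (u i + v i) = 0 /\ mx_ip b (u i + v i) = 0,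
        forall i : 'I_ell.+2, (0 < i)%N ->
          [/\ psd (u i),
              psd (block_mx (\sum_(j < ell.+2 | (j < i)%N) u j) (w i)
                            (w i)^T (beta i)%:M) &
              v i = w i + (w i)^T] &
        u ord0 = 0 /\ v ord0 = 0]].

Definition sdp_ext_objective (n : nat) (b : 'M[R]_n) (ell : nat)
    (z : sdp_ext_var n ell) : R :=
  mx_ip b (ext_u z ord_max + ext_v z ord_max).

End Semidefinite.

(* Main.v *)
(* Write C' for the dual cone of C, and let s be the slack of a relative interior
   point of the feasible set, so that F_min is the smallest face of K containing s.

   Facial reduction: if a face F strictly contains F_min, then no point of the
   span of b and the range of A is relatively interior to F, so the M. Riesz
   extension theorem yields y in F' orthogonal to that span, i.e. y in L, and not
   orthogonal to F; then F_min is contained in the smaller face of F orthogonal to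
   y. Every such step lengthens a chain of faces of K and adds an element
   independent of the previous ones to L, so ell steps reach F_min. For an exposed
   face F, the part of K orthogonal to some u in K', niceness gives F' = K' + F^perp,
   and F^perp = tan (u, K') by the bipolar theorem: this is how (EXT_nice) encodes
   the reduction. Strong duality over F_min is again a Riesz extension, s being an
   order unit of F_min.

   The semidefinite case runs the same argument in the space of symmetric
   matrices. There the faces cut out by the partial sums of the u_i shrink only
   when the rank of the sum grows, which bounds the number of steps by n. *)

(* Relative interior points act through an algebraic substitute, the order unit: a point of a cone
   some multiple of which exceeds any given element of the cone. This is exactly the domination
   condition of the Riesz extension, so the separation arguments ask for no closed faces and no
   closed sums. Closedness of [K] and niceness enter only through the bipolar theorem, which turns
   them into identities between dual cones.

   The reduction is proved for abstract bounds: [N] on the number of strict steps, [d] on the size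
   of a free family annihilating the data, and any [ell] at least the smaller of the two, surplus
   steps being filled with zeros. The two parts of the theorem differ in these bounds and in the
   source of the decomposition of [F']: closedness for a nice cone, an explicit compression to a
   kernel for matrices. *)
From HB Require Import structures.
Require Import Defs.
From mathcomp Require Import all_boot all_order all_algebra.
From mathcomp Require Import boolp classical_sets functions reals ereal.
From mathcomp Require Import interval_inference convex.
From mathcomp Require Import ring lra.

Set Implicit Arguments.
Unset Strict Implicit.
Unset Printing Implicit Defensive.

Import Order.TTheory GRing.Theory Num.Theory.

Local Open Scope classical_set_scope.
Local Open Scope ring_scope.

(** * Inner products *)

Section InnerProduct.
Context {R : realType} {V : vectType R}.
Variable ip : {dot V for idfun}.
Implicit Types (x y z : V) (U : {vspace V}).

Lemma ipC x y : ip x y = ip y x.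
Proof. by rewrite hermitian_subproof expr0 mul1r. Qed.

Lemma ipDl x y z : ip (x + y) z = ip x z + ip y z.
Proof. exact: linearDl. Qed.

Lemma ipDr x y z : ip x (y + z) = ip x y + ip x z.
Proof. exact: linearDr. Qed.

Lemma ipZl t x y : ip (t *: x) y = t * ip x y.
Proof. exact: linearZl_LR. Qed.

Lemma ipZr t x y : ip x (t *: y) = t * ip x y.
Proof. exact: linearZr_LR. Qed.

Lemma ip0l y : ip 0 y = 0.
Proof. exact: linear0l. Qed.

Lemma ip0r x : ip x 0 = 0.
Proof. exact: linear0r. Qed.

Lemma ipNl x y : ip (- x) y = - ip x y.
Proof. exact: linearNl. Qed.

Lemma ipNr x y : ip x (- y) = - ip x y.
Proof. exact: linearNr. Qed.

Lemma ipBr x y z : ip x (y - z) = ip x y - ip x z.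
Proof. exact: linearBr. Qed.

Lemma ip_suml I (r : seq I) (P : pred I) (F : I -> V) y :
  ip (\sum_(i <- r | P i) F i) y = \sum_(i <- r | P i) ip (F i) y.
Proof. exact: linear_sumlz. Qed.

Lemma ip_sumr I (r : seq I) (P : pred I) (F : I -> V) x :
  ip x (\sum_(i <- r | P i) F i) = \sum_(i <- r | P i) ip x (F i).
Proof. exact: linear_sumr. Qed.

Lemma ip_gt0 x : x != 0 -> 0 < ip x x.
Proof. exact: neq0_dnorm_gt0. Qed.

Lemma ip_ge0 x : 0 <= ip x x.
Proof. by have [->|/ip_gt0/ltW//] := eqVneq x 0; rewrite ip0l. Qed.

Lemma ip_eq0 x : ip x x = 0 -> x = 0.
Proof. by apply: contra_eq => /ip_gt0; rewrite lt0r => /andP[]. Qed.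

(** The Gram matrix [G] of a basis is invertible: a vector of its left kernel gives a [z] orthogonal
    to the basis, hence to itself. The coordinates of the representing vector then solve a linear
    system with matrix [G]. *)
Lemma riesz_representation (f : V -> R) :
  (forall a x y, f (a *: x + y) = a * f x + f y) ->
  exists z, forall x, ip z x = f x.
Proof.
move=> linf.
have @g : {linear V -> R^o} :=
  HB.pack f (GRing.isLinear.Build R V R^o _ f linf).
pose e := vbasis (fullv : {vspace V}).
have fe : free e := basis_free (vbasisP _).
pose G : 'M[R]_(\dim (fullv : {vspace V})) := \matrix_(i, j) ip e`_i e`_j.
have uG : G \in unitmx.
  rewrite -row_free_unit -kermx_eq0; apply/eqP/row_matrixP => i; rewrite row0.
  set v := row i _.
  have vG : v *m G = 0 by rewrite -row_mul mulmx_ker row0.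
  pose z := \sum_j v 0 j *: e`_j.
  have ze (j : 'I_(\dim (fullv : {vspace V}))) : ip z e`_j = 0.
    have := congr1 (fun M : 'rV_(\dim (fullv : {vspace V})) => M 0 j) vG.
    rewrite !mxE => vG0.
    rewrite /z ip_suml -[RHS]vG0; apply: eq_bigr => k _.
    by rewrite ipZl !mxE.
  have z0 : z = 0.
    apply: ip_eq0; rewrite {2}/z ip_sumr big1 // => j _.
    by rewrite ipZr ze mulr0.
  apply/rowP => j; rewrite [RHS]mxE.
  by move/freeP: fe => /(_ (fun j => v 0 j) z0 j).
pose c := (\row_j g e`_j) *m invmx G.
exists (\sum_i c 0 i *: e`_i) => x.
change (f x) with (g x).
rewrite (coord_vbasis (memvf x)) ip_sumr [RHS]linear_sum; apply: eq_bigr => j _.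
rewrite ipZr [RHS]linearZ; congr (_ * _).
have : (c *m G) 0 j = g e`_j by rewrite mulmxKV // mxE.
rewrite mxE => <-; rewrite ip_suml; apply: eq_bigr => i _.
by rewrite ipZl [G i j]mxE.
Qed.

(** [projv] is an algebraic projector unrelated to [ip], so the residue [w] need not be orthogonal
    to [U]. Instead, [h] represents the product of [w] with [x - projv U x], a functional of [x]
    that vanishes on [U], scaled to 1 at [v]. *)
Lemma orthogonal_separation U v : v \notin U ->
  exists2 h, (forall w, w \in U -> ip h w = 0) & ip h v = 1.
Proof.
move=> vU; pose w := v - projv U v.
have w0 : ip w w != 0.
  apply: contraNneq vU => /ip_eq0 /eqP; rewrite subr_eq0 => /eqP ->.
  exact: memv_proj.
have [|h hE] := @riesz_representation (fun x => ip w (x - projv U x) / ip w w).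
  move=> a x y; rewrite linearP mulrA -mulrDl -ipZr -ipDr; congr (ip w _ / _).
  by rewrite scalerBr opprD addrACA.
exists h; last by rewrite hE divff.
by move=> u uU; rewrite hE projv_id // subrr ip0r mul0r.
Qed.

Lemma cauchy_schwarz x y : ip x y ^+ 2 <= ip x x * ip y y.
Proof.
have [->|y0] := eqVneq y 0; first by rewrite !ip0r expr0n mulr0.
have yy := ip_gt0 y0.
have := ip_ge0 (ip y y *: x - ip x y *: y).
rewrite ipBr !ipZr ![ip (_ - _) _]ipC !ipBr !ipZr (ipC y x).
move=> h; have : 0 <= ip y y * (ip x x * ip y y - ip x y ^+ 2) by nra.
by rewrite pmulr_rge0 // subr_ge0.
Qed.

Lemma sqr_enorm x : enorm ip x ^+ 2 = ip x x.
Proof. by rewrite sqr_sqrtr // ip_ge0. Qed.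

Lemma enorm_ge0 x : 0 <= enorm ip x.
Proof. exact: sqrtr_ge0. Qed.

Lemma ip_le_enorm x y : ip x y <= enorm ip x * enorm ip y.
Proof.
apply: le_trans (ler_norm _) _.
rewrite -(@ler_pXn2r _ 2) ?nnegrE ?mulr_ge0 ?enorm_ge0 //.
by rewrite exprMn !sqr_enorm real_normK ?num_real // cauchy_schwarz.
Qed.

Lemma enormZ t x : enorm ip (t *: x) = `|t| * enorm ip x.
Proof.
rewrite /enorm ipZl ipZr mulrA -expr2 sqrtrM ?sqr_ge0 //.
by rewrite sqrtr_sqr.
Qed.

Lemma enormN x : enorm ip (- x) = enorm ip x.
Proof. by rewrite -scaleN1r enormZ normrN1 mul1r. Qed.

Lemma enorm0 : enorm ip 0 = 0.
Proof. by rewrite /enorm ip0l sqrtr0. Qed.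

Lemma ler_enormD x y : enorm ip (x + y) <= enorm ip x + enorm ip y.
Proof.
rewrite -(@ler_pXn2r _ 2) ?nnegrE ?addr_ge0 ?enorm_ge0 //.
rewrite sqrrD !sqr_enorm ipDl !ipDr (ipC y x).
have := ip_le_enorm x y; lra.
Qed.

End InnerProduct.

(** * Cones and the Riesz extension theorem *)

Section Cones.
Context {R : realType} {V : vectType R}.
Variable ip : {dot V for idfun}.
Implicit Types (x y z : V) (U : {vspace V}) (C F : set V).

Definition convex_cone C :=
  [/\ C 0, forall x y, C x -> C y -> C (x + y) &
      forall t x, 0 <= t -> C x -> C (t *: x)].

Definition order_unit C p :=
  C p /\ forall x, C x -> exists2 N : R, 0 <= N & C (N *: p - x).

Lemma perpE C z : perp ip C z <-> forall x, C x -> ip z x = 0.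
Proof.
split=> [h x Cx|h _ [k [t [p [Cp ->]]]]].
  apply: h; exists 1, (fun=> 1), (fun=> x); split=> //.
  by rewrite big_ord1 scale1r.
by rewrite ip_sumr big1 // => i _; rewrite ipZr h ?mulr0.
Qed.

Lemma dual_coneS C F : C `<=` F -> dual_cone ip F `<=` dual_cone ip C.
Proof. by move=> sCF z zF x /sCF /zF. Qed.

Lemma dual_cone_convex C : convex_cone (dual_cone ip C).
Proof.
split=> [x _|x y Cx Cy z Cz|t x t0 Cx z Cz]; first by rewrite ip0l.
  by rewrite ipDl addr_ge0 ?Cx ?Cy.
by rewrite ipZl mulr_ge0 ?Cx.
Qed.

(** In the order of [C], an admissible value at [v] must lie above [z0] on the elements of [U] below
    [v] and under [z0] on those above [v]; positivity of [z0] on [U] puts the first values under the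
    second. *)
Lemma extension_value C U z0 v : convex_cone C ->
  (forall w, w \in U -> C w -> 0 <= ip z0 w) ->
  (forall x, C x -> exists2 w, w \in U & C (w - x)) ->
  exists a : R, (forall w, w \in U -> C (v - w) -> ip z0 w <= a) /\
                (forall w, w \in U -> C (w - v) -> a <= ip z0 w).
Proof.
move=> [C0 CD CZ] z0C dom.
have le w1 w2 : w1 \in U -> w2 \in U -> C (v - w1) -> C (w2 - v) ->
    ip z0 w1 <= ip z0 w2.
  move=> U1 U2 C1 C2; rewrite -subr_ge0 -ipBr; apply: z0C; first exact: rpredB.
  by have := CD _ _ C2 C1; rewrite addrA subrK.
have [[w0 U0 C0']|nolow] := pselect (exists2 w, w \in U & C (v - w)); last first.
  (* [U] has no element above [v] either: if [w'] dominates [w - v], then [w - w'] is below [v]. *)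
  exists 0; split=> w Uw Cw; first by case: nolow; exists w.
  have [w' Uw' Cw'] := dom _ Cw; case: nolow; exists (w - w').
    exact: rpredB.
  by rewrite opprB addrC addrAC -addrA -opprB.
have [w1 U1 C1] := dom _ C0'.
have C2 : C (w0 + w1 - v) by move: C1; rewrite opprB addrCA addrA.
pose S := [set r | exists2 w, w \in U /\ C (v - w) & r = ip z0 w].
have S0 : S !=set0 by exists (ip z0 w0), w0.
exists (sup S); split=> w Uw Cw.
  apply: ub_le_sup; last by exists w.
  exists (ip z0 (w0 + w1)) => _ [w' [Uw' Cw'] ->]; apply: le => //.
  exact: rpredD.
by apply: ge_sup => // _ [w' [Uw' Cw'] ->]; apply: le.
Qed.

(* M. Riesz: extend one dimension at a time; domination of C by U makes the
   interval of admissible values nonempty. *)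
Lemma riesz_extension C U z0 : convex_cone C ->
  (forall w, w \in U -> C w -> 0 <= ip z0 w) ->
  (forall x, C x -> exists2 w, w \in U & C (w - x)) ->
  exists2 z, dual_cone ip C z & forall w, w \in U -> ip z w = ip z0 w.
Proof.
move=> cC; have := leqnn (\dim (fullv : {vspace V}) - \dim U)%N.
move: {2}(_ - _)%N => n.
elim: n U z0 => [|n IHn] U z0 dimU z0C dom.
  exists z0 => // x Cx; apply: z0C => //.
  suff -> : U = fullv by exact: memvf.
  apply/eqP; rewrite eqEdim subvf /=.
  by rewrite leqn0 subn_eq0 in dimU.
have [fU|/subvPn [v _ vU]] := boolP (fullv <= U)%VS.
  by exists z0 => // x Cx; apply: z0C => //; apply: (subvP fU); apply: memvf.
have [a [lo up]] := extension_value v cC z0C dom.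
have [h hU hv] := orthogonal_separation ip vU.
pose z1 := z0 + (a - ip z0 v) *: h.
have z1U w : w \in U -> ip z1 w = ip z0 w.
  by move=> Uw; rewrite ipDl ipZl hU // mulr0 addr0.
have z1v : ip z1 v = a by rewrite ipDl ipZl hv mulr1 addrC subrK.
have [] := IHn (U + <[v]>)%VS z1.
- have : (\dim (U + <[v]>) = \dim U + 1)%N.
    rewrite dimv_disjoint_sum ?dim_vline.
      by have [v0|//] := eqVneq v 0; rewrite v0 mem0v in vU.
    apply/eqP; rewrite -subv0; apply/subvP => x /memv_capP [xU /vlineP [t xt]].
    have [t0|t0] := eqVneq t 0; first by rewrite xt t0 scale0r mem0v.
    case/negP: vU; rewrite -[v](scalerK t0) -xt; exact: rpredZ.
  by move=> ->; rewrite subnDA leq_subLR add1n.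
- move=> _ /memv_addP [w Uw [_ /vlineP [t ->] ->]] Cwt.
  rewrite ipDr ipZr z1U // z1v.
  case: cC => C0 CD CZ.
  have [t0|t0|t0] := ltgtP t 0; last by
    move: Cwt; rewrite t0 scale0r addr0 mul0r addr0; apply: z0C.
  + have : C ((- t)^-1 *: w - v).
      have -> : (- t)^-1 *: w - v = (- t)^-1 *: (w + t *: v).
        by rewrite scalerDr scalerA invrN mulNr mulVf ?scaleN1r ?lt_eqF.
      by apply: CZ => //; rewrite invr_ge0 oppr_ge0 ltW.
    move/(up _ (rpredZ _ Uw)); rewrite ipZr ler_pdivlMl ?oppr_gt0 //.
    by rewrite mulNr -subr_ge0 opprK.
  + have : C (v - (- t^-1 *: w)).
      have -> : v - (- t^-1 *: w) = t^-1 *: (w + t *: v).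
        by rewrite scalerDr scalerA mulVf ?gt_eqF // scale1r scaleNr opprK addrC.
      by apply: CZ => //; rewrite invr_ge0 ltW.
    move/(lo _ (rpredZ _ Uw)); rewrite ipZr mulNr lerNl ler_pdivlMl //.
    by rewrite mulrN -subr_ge0 opprK.
- move=> x /dom [w Uw Cw]; exists w => //; apply: subvP Uw; exact: addvSl.
move=> z zC zU; exists z => // w Uw; rewrite -z1U // zU //.
by apply: subvP Uw; exact: addvSl.
Qed.

(** The functional vanishing on [U] and equal to 1 at [p] is nonnegative on the part of [F] in
    [U + R p], because a negative coefficient of [p] would rescale to an element of the excluded
    form [w - p]. That subspace contains the order unit [p], so the functional extends. *)
Lemma reducing_certificate F p U : convex_cone F -> order_unit F p ->
  (forall w, w \in U -> ~ F (w - p)) ->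
  exists z, [/\ dual_cone ip F z, forall w, w \in U -> ip z w = 0 & 0 < ip z p].
Proof.
move=> cF [Fp dom] noint; have [F0 FD FZ] := cF.
have pU : p \notin U by apply/negP => /noint; rewrite subrr.
have [h hU hp] := orthogonal_separation ip pU.
have [||z zF zU] := @riesz_extension F (U + <[p]>)%VS h cF.
- move=> _ /memv_addP [w Uw [_ /vlineP [t ->] ->]] Fwt.
  rewrite ipDr ipZr hU // hp mulr1 add0r leNgt; apply/negP => t0.
  apply: (noint ((- t)^-1 *: w)); first exact: rpredZ.
  have -> : (- t)^-1 *: w - p = (- t)^-1 *: (w + t *: p).
    by rewrite scalerDr scalerA invrN mulNr mulVf ?scaleN1r ?lt_eqF.
  by apply: FZ => //; rewrite invr_ge0 oppr_ge0 ltW.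
- move=> x /dom [N N0 Fx]; exists (N *: p) => //.
  by apply: subvP (rpredZ N (memv_line p)); exact: addvSr.
exists z; split=> // [w Uw|]; last first.
  by rewrite zU ?hp //; apply: subvP (memv_line p); exact: addvSr.
by rewrite zU ?hU //; apply: subvP Uw; exact: addvSl.
Qed.

Lemma eclosure_ge0 C z y :
  (forall x, C x -> 0 <= ip z x) -> eclosure ip C y -> 0 <= ip z y.
Proof.
move=> zC clC; rewrite leNgt; apply/negP => zy0.
have z1 : 0 < enorm ip z + 1 by rewrite ltr_wpDl ?enorm_ge0.
have e0 : 0 < - ip z y / (enorm ip z + 1) by rewrite divr_gt0 ?oppr_gt0.
have [x /zC zx] := clC _ e0; rewrite ltr_pdivlMr // => yx.
have := ip_le_enorm ip (- z) (y - x); rewrite enormN ipNl ipBr.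
have := enorm_ge0 ip z; have := enorm_ge0 ip (y - x); nra.
Qed.

(* If y had a ball disjoint from C, the functional -1 on y would be nonnegative
   on C minus the cone over the ball, which is dominated by the line of y. *)
Lemma bipolar C : convex_cone C ->
  dual_cone ip (dual_cone ip C) `<=` eclosure ip C.
Proof.
move=> [C0 CD CZ] y yC e e0; apply: contrapT => nex.
have noball c : C c -> e <= enorm ip (y - c).
  by move=> Cc; rewrite leNgt; apply/negP => yc; apply: nex; exists c.
pose D := [set x | exists c t q,
  [/\ C c, 0 <= t, enorm ip q <= t * (e / 2) & x = c - (t *: y + q)]].
have cD : convex_cone D.
  split.
  - by exists 0, 0, 0; split; rewrite ?scale0r ?mul0r ?enorm0 ?addr0 ?subr0.
  - move=> _ _ [c [t [q [Cc t0 qt ->]]]] [c' [t' [q' [Cc' t0' qt' ->]]]].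
    exists (c + c'), (t + t'), (q + q'); split; rewrite ?addr_ge0 //.
    + exact: CD.
    + by rewrite mulrDl (le_trans (ler_enormD _ _ _)) ?lerD.
    + by rewrite scalerDl addrACA -opprD addrACA.
  - move=> s _ s0 [c [t [q [Cc t0 qt ->]]]].
    exists (s *: c), (s * t), (s *: q); split; rewrite ?mulr_ge0 //.
    + exact: CZ.
    + by rewrite enormZ ger0_norm // -mulrA ler_wpM2l.
    + by rewrite scalerBr scalerDr scalerA.
have y0 : y != 0.
  apply/eqP => y0; have := noball _ C0.
  by rewrite y0 subr0 enorm0 leNgt e0.
have yy := ip_gt0 ip y0.
have [||z zD zy] := @riesz_extension D <[y]>%VS (- (ip y y)^-1 *: y) cD.
- move=> _ /vlineP [s ->] [c [t [q [Cc t0 qt sy]]]].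
  rewrite ipZl ipZr mulrCA mulNr mulVf ?gt_eqF // mulrN1 oppr_ge0.
  rewrite leNgt; apply/negP => s0.
  have st : 0 < s + t by rewrite ltr_pwDl.
  have cE : (s + t)^-1 *: c = y + (s + t)^-1 *: q.
    have -> : c = (s + t) *: y + q by rewrite scalerDl sy -addrA subrK.
    by rewrite scalerDr scalerA mulVf ?gt_eqF // scale1r.
  have := noball _ (CZ _ _ (ltW _) Cc); rewrite -invr_gt0 in st.
  move=> /(_ _ st); rewrite cE opprD addrA subrr sub0r enormN enormZ.
  rewrite gtr0_norm //; rewrite invr_gt0 in st; rewrite ler_pdivlMl //; nra.
- move=> x _; pose N := enorm ip x / (e / 2).
  have N0 : 0 <= N by rewrite divr_ge0 ?enorm_ge0 ?divr_ge0 ?ltW.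
  exists (- N *: y); first by rewrite memvZ ?memv_line.
  exists 0, N, x; split=> //; last by rewrite sub0r opprD scaleNr.
  by rewrite divfK // gt_eqF ?divr_gt0.
have zdual : dual_cone ip C z.
  move=> c Cc; apply: zD; exists c, 0, 0; split=> //.
    by rewrite enorm0 mul0r.
  by rewrite scale0r addr0 subr0.
have := yC _ zdual; rewrite ipC zy ?memv_line // ipZl mulNr mulVf ?gt_eqF //.
by rewrite oppr_ge0 ler10.
Qed.

End Cones.

(** * Conic duality in the presence of an order unit *)

Section ConicDuality.
Context {R : realType} {X V : vectType R}.
Variable ip : {dot V for idfun}.
Variables (A : {linear X -> V}) (b : V) (f : X -> R) (F : set V).
Hypothesis linf : forall a x y, f (a *: x + y) = a * f x + f y.

(** Slater's argument relative to [F]: on the span of [b] and the range of [A] a functional is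
    prescribed, [f] on the range and the optimal value at [b]. The slack [b - A x0] lies in that
    span and dominates [F], so a nonnegative extension exists, and it solves the dual. *)
Lemma conic_strong_duality x0 (beta : R) : convex_cone F ->
  order_unit F (b - A x0) ->
  (forall x, F (b - A x) -> f x <= beta) ->
  exists y, [/\ dual_cone ip F y, forall x, ip y (A x) = f x & ip y b <= beta].
Proof.
move=> cF [Fx0 dom] ub; have [F0 FD FZ] := cF.
have @g : {linear X -> R^o} :=
  HB.pack f (GRing.isLinear.Build R X R^o _ f linf).
have fD x y : f (x + y) = f x + f y := linearD g x y.
have fZ a x : f (a *: x) = a * f x := linearZ_LR g a x.
have fN x : f (- x) = - f x := linearN g x.
have recession x : F (A x) -> 0 <= f x.
  move=> FAx; rewrite leNgt; apply/negP => fx0.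
  (* A step of this length from [x0] against [x] would give the objective value [beta + 1]. *)
  have t0 : 0 <= (f x0 - beta - 1) / f x.
    rewrite ler_ndivlMr // mul0r.
    by have := ub _ Fx0; lra.
  have /ub : F (b - A (x0 - ((f x0 - beta - 1) / f x) *: x)).
    rewrite linearB opprB addrA addrAC linearZ; apply: FD => //; exact: FZ.
  rewrite fD fN fZ divfK ?lt_eqF //; lra.
pose T := linfun A.
have TE x : T x = A x := lfunE A x.
have linpsi a x y : f ((T^-1)%VF (a *: x + y)) =
    a * f ((T^-1)%VF x) + f ((T^-1)%VF y) by rewrite linearP linf.
have [z1 z1E] := riesz_representation ip linpsi.
(* [T^-1] picks an arbitrary preimage. This is harmless: the difference of two preimages and its
   opposite are both recession directions, so [f] vanishes on it. *)
have z1A x : ip z1 (A x) = f x.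
  rewrite z1E; set x' := (T^-1)%VF _.
  have Ax' : A x' = A x.
    by rewrite -!TE /x' -TE limg_lfunVK // memv_img // memvf.
  have := recession (x' - x); have := recession (x - x').
  by rewrite !linearB Ax' subrr !fD !fN => /(_ F0) + /(_ F0); lra.
have limgT w : w \in limg T -> exists x, w = A x.
  by move=> /memv_imgP [x _ ->]; exists x; rewrite TE.
have AT x : A x \in limg T by rewrite -TE memv_img // memvf.
have [/limgT [xb bE]|bT] := boolP (b \in limg T).
  have [||z zF zT] := @riesz_extension _ _ ip F (limg T) z1 cF.
  - by move=> w /limgT [x ->]; rewrite z1A; apply: recession.
  - move=> x /dom [N N0 Fx]; exists (N *: (b - A x0)) => //.
    by rewrite bE rpredZ // rpredB.
  exists z; split=> // [x|]; first by rewrite zT.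
  by rewrite bE zT // z1A ub // bE subrr.
have [h hT hb] := orthogonal_separation ip bT.
pose S := [set f x | x in [set x | F (b - A x)]].
have S0 : S !=set0 by exists (f x0), x0.
have Sub : has_ubound S by exists beta => _ [x Fx <-]; apply: ub.
pose s := sup S.
have fs x : F (b - A x) -> f x <= s by move=> Fx; apply: ub_le_sup => //; exists x.
have sbeta : s <= beta by apply: ge_sup => // _ [x Fx <-]; apply: ub.
pose z0 := z1 + (s - ip z1 b) *: h.
have z0A x : ip z0 (A x) = f x by rewrite ipDl ipZl hT // mulr0 addr0 z1A.
have z0b : ip z0 b = s by rewrite ipDl ipZl hb mulr1 addrC subrK.
have TU : (limg T <= limg T + <[b]>)%VS by exact: addvSl.
have bU : b \in (limg T + <[b]>)%VS by apply: subvP (memv_line b); exact: addvSr.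
have [||z zF zT] := @riesz_extension _ _ ip F (limg T + <[b]>)%VS z0 cF.
- move=> _ /memv_addP [_ /limgT [x ->] [_ /vlineP [t ->] ->]] Fx.
  rewrite ipDr ipZr z0A z0b.
  have [t0|t0|t0] := ltgtP t 0; last by
    move: Fx; rewrite t0 scale0r addr0 mul0r addr0; apply: recession.
  (* For [t < 0], adding [- t] times the slack of a feasible [x'] cancels [b], so [x + t x'] is a
     recession direction; then take the supremum over [x']. *)
  + rewrite leNgt; apply/negP => neg.
    suff : s <= f x / - t by rewrite ler_pdivlMr ?oppr_gt0 //; lra.
    apply: ge_sup => // _ [x' Fx' <-]; rewrite ler_pdivlMr ?oppr_gt0 //.
    have /recession : F (A (x + t *: x')).
      have -> : A (x + t *: x') = A x + t *: b + (- t) *: (b - A x').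
        by rewrite linearD linearZ /= scalerBr !scaleNr opprK addrA addrK.
      by apply: FD => //; apply: FZ; rewrite // oppr_ge0 ltW.
    by rewrite fD fZ; lra.
  + have /fs : F (b - A (- t^-1 *: x)).
      have -> : b - A (- t^-1 *: x) = t^-1 *: (A x + t *: b).
        rewrite linearZ /= scaleNr opprK scalerDr scalerA mulVf ?gt_eqF //.
        by rewrite scale1r addrC.
      by apply: FZ; rewrite // invr_ge0 ltW.
    rewrite fZ mulNr lerNl ler_pdivlMl //; lra.
- move=> x /dom [N N0 Fx]; exists (N *: (b - A x0)) => //.
  by rewrite rpredZ // rpredB // (subvP TU).
exists z; split=> // [x|]; last by rewrite zT // z0b.
by rewrite zT // (subvP TU).
Qed.

End ConicDuality.

(** * Relative interiors and faces *)

Section ConvexSets.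
Context {R : realType} {V : vectType R}.
Variable ip : {dot V for idfun}.
Implicit Types (x y z : V) (U : {vspace V}) (C F K S : set V).

Lemma convex_setP C : @convex_set R V C <->
  forall x y (t : R), 0 <= t <= 1 -> C x -> C y -> C (t *: x + (1 - t) *: y).
Proof.
split=> [cC x y t /andP[t0 t1] Cx Cy|cC x y l].
  by have := cC x y (Itv01 t0 t1); rewrite !inE => /(_ Cx Cy).
by rewrite !inE => Cx Cy; apply: cC => //; rewrite ge0 le1.
Qed.

Lemma convex_combination C (I : Type) (r : seq I) (c : I -> R) (v : I -> V) :
  @convex_set R V C -> C 0 -> (forall i, 0 <= c i) -> (forall i, C (v i)) ->
  exists2 w, C w & \sum_(i <- r) c i *: v i = (\sum_(i <- r) c i) *: w.
Proof.
move=> /convex_setP cC C0 c0 Cv; elim: r => [|i r [w Cw IH]].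
  by exists 0; rewrite ?big_nil ?scaler0.
rewrite !big_cons IH; set t := \sum_(j <- r) c j.
have t0 : 0 <= t by apply: sumr_ge0.
have [/eqP|n0] := eqVneq (c i + t) 0.
  rewrite paddr_eq0 // => /andP [/eqP -> /eqP ->].
  by exists 0; rewrite ?add0r ?scale0r ?addr0.
have p0 : 0 < c i + t by rewrite lt_def n0 addr_ge0.
exists ((c i / (c i + t)) *: v i + (1 - c i / (c i + t)) *: w).
  apply: cC => //; rewrite divr_ge0 ?addr_ge0 //=.
  by rewrite ler_pdivrMr // mul1r lerDl.
rewrite scalerDr !scalerA mulrBr mulr1 mulrCA mulfV // mulr1.
by rewrite [c i + t - _]addrAC subrr add0r.
Qed.

Lemma exists_free_spanning S : exists s : seq V,
  [/\ free s, forall x, x \in s -> S x & forall x, S x -> x \in <<s>>%VS].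
Proof.
suff H n s : (\dim (fullv : {vspace V}) - size s <= n)%N -> free s ->
    (forall x, x \in s -> S x) -> exists s : seq V,
  [/\ free s, forall x, x \in s -> S x & forall x, S x -> x \in <<s>>%VS].
  by apply: (H _ [::]) => //; exact: nil_free.
elim: n s => [|n IHn] s sz fs sS.
  exists s; split=> // x _; suff -> : <<s>>%VS = fullv by exact: memvf.
  apply/eqP; rewrite eqEdim subvf /=; rewrite leqn0 subn_eq0 in sz.
  by rewrite (eqnP fs).
have [[x Sx xs]|no] := pselect (exists2 x, S x & x \notin <<s>>%VS).
  apply: (IHn (x :: s)); rewrite ?free_cons ?xs //=.
    by rewrite -addn1 subnDA leq_subLR add1n.
  by move=> y; rewrite inE => /predU1P [->|/sS].
exists s; split=> // x Sx; apply: contrapT => /negP xs; apply: no; by exists x.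
Qed.

Lemma exists_span S : exists U, forall z, lin_span S z <-> z \in U.
Proof.
have [s [fs sS Ss]] := exists_free_spanning S; exists <<s>>%VS => z.
split=> [[k [t [p [Sp ->]]]]|zs].
  by apply: rpred_sum => i _; apply/rpredZ/Ss/Sp.
exists (size s), (fun i => coord (in_tuple s) i z), (fun i => s`_i).
by split=> [i|]; [apply/sS/mem_nth|exact: (coord_span (X := in_tuple s))].
Qed.

Lemma aff_hull_sub S U y : S y -> (forall x, S x -> x - y \in U) ->
  forall z, aff_hull S z -> z - y \in U.
Proof.
move=> Sy SU z [k [t [p [Sp t1 ->]]]].
have -> : \sum_i t i *: p i - y = \sum_i t i *: (p i - y).
  rewrite -[X in _ - X]scale1r -t1 scaler_suml -sumrB.
  by apply: eq_bigr => i _; rewrite scalerBr.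
by apply: rpred_sum => i _; apply/rpredZ/SU/Sp.
Qed.

Lemma aff_hull_lin_span S z : S 0 -> lin_span S z -> aff_hull S z.
Proof.
move=> S0 [k [t [p [Sp ->]]]].
exists k.+1, (fun i => if unlift ord0 i is Some j then t j else 1 - \sum_j t j),
  (fun i => if unlift ord0 i is Some j then p j else 0).
split=> [i||]; first by case: unliftP.
  by rewrite big_ord_recl unlift_none; under [X in _ + X]eq_bigr do
    rewrite liftK; rewrite subrK.
rewrite big_ord_recl unlift_none scaler0 add0r.
by apply: eq_bigr => j _; rewrite liftK.
Qed.

(* The barycentre of affinely independent points spanning C is relatively
   interior. *)
Lemma relint_nonempty C : @convex_set R V C -> C !=set0 -> relint ip C !=set0.
Proof.
move=> cC [y0 Cy0]; pose S := [set v | C (y0 + v)].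
have cS : @convex_set R V S.
  apply/convex_setP => x y t t01 Sx Sy; rewrite /S /=.
  have -> : y0 + (t *: x + (1 - t) *: y) =
      t *: (y0 + x) + (1 - t) *: (y0 + y).
    by rewrite !scalerDr addrACA -scalerDl [t + _]addrC subrK scale1r.
  by move/convex_setP: cC; apply.
have S0 : S 0 by rewrite /S /= addr0.
have [s [fs sS Ss]] := exists_free_spanning S.
(* [c] is the common barycentric coordinate of the centre of the simplex with the [k + 1] vertices
   [0] and [s]. *)
pose k := size s; pose c : R := k.+1%:R^-1.
have c0 : 0 < c by rewrite invr_gt0 ltr0n.
have Sn (i : 'I_k) : S s`_i by apply/sS/mem_nth.
have inS (d : 'I_k -> R) : (forall i, 0 <= d i) -> \sum_i d i <= 1 ->
    S (\sum_i d i *: s`_i).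
  move=> d0 d1; have [w Sw ->] := convex_combination (index_enum 'I_k) cS S0 d0 Sn.
  move/convex_setP: cS => /(_ w 0 (\sum_i d i)); rewrite scaler0 addr0; apply=> //.
  by rewrite d1 andbT sumr_ge0.
have /choice [h hE] : forall i : 'I_k, exists h, forall x,
    ip h x = coord (in_tuple s) i x.
  by move=> i; apply: riesz_representation => a x y; rewrite linearP.
(* [M] exceeds the sum of the norms of the coordinate functionals, so within distance [c / M] of the
   centre the coordinates move by at most [c] in total: they stay nonnegative with sum at most 1. *)
pose M := 1 + \sum_i enorm ip (h i).
have M1 : 1 <= M by rewrite lerDl sumr_ge0 // => i _; exact: enorm_ge0.
have M0 : 0 < M by exact: lt_le_trans M1.
pose x0 := \sum_(i < k) c *: s`_i.
have kc : k%:R * c = 1 - c.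
  rewrite /c -[in RHS](@mulfV _ k.+1%:R) ?pnatr_eq0 // -natr1.
  by field; rewrite natr1 pnatr_eq0.
have sc : \sum_(i < k) c = 1 - c by rewrite sumr_const card_ord -mulr_natl kc.
exists (y0 + x0); split.
  by apply: inS => [_|]; [exact: ltW|rewrite sc; lra].
exists (c / M); first by rewrite divr_gt0.
move=> z affz zx; have zs : z - y0 \in <<s>>%VS.
  by apply: aff_hull_sub affz => // x Cx; apply: Ss; rewrite /S /= addrCA subrr addr0.
pose d i := coord (in_tuple s) i (z - y0).
have dE i : d i = c + ip (h i) (z - (y0 + x0)).
  have cx0 : coord (in_tuple s) i x0 = c.
    exact: (@coord_sum_free _ _ _ (in_tuple s) (fun=> c)).
  by rewrite hE opprD addrA linearB /= -/(d i) cx0 addrC subrK.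
have dh i : `|ip (h i) (z - (y0 + x0))| <= enorm ip (h i) * (c / M).
  rewrite ler_norml lerNl -ipNr; apply/andP; split;
    apply: le_trans (ip_le_enorm _ _ _) _;
    by rewrite ?enormN ler_wpM2l ?enorm_ge0 // ltW.
have hM i : enorm ip (h i) <= M.
  rewrite /M (bigD1 i) //= addrCA lerDl addr_ge0 // sumr_ge0 // => j _.
  exact: enorm_ge0.
have : S (\sum_i d i *: s`_i).
  apply: inS => [i|].
    have := dh i; rewrite dE ler_norml => /andP [+ _].
    have : enorm ip (h i) * (c / M) <= c.
      by rewrite mulrA ler_pdivrMr // mulrC ler_wpM2l // ltW.
    lra.
  have -> : \sum_i d i = 1 - c + \sum_i ip (h i) (z - (y0 + x0)).
    rewrite -sc -big_split /=.
    by apply: eq_bigr => i _; rewrite dE.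
  have : \sum_i ip (h i) (z - (y0 + x0)) <= \sum_i enorm ip (h i) * (c / M).
    by apply: ler_sum => i _; apply: le_trans (ler_norm _) (dh i).
  rewrite -mulr_suml.
  have : (\sum_i enorm ip (h i)) * (c / M) <= c.
    rewrite mulrA ler_pdivrMr // mulrC ler_wpM2l ?(ltW c0) //.
    by rewrite /M lerDr.
  lra.
rewrite /S /= /d -(coord_span (X := in_tuple s)) //.
by rewrite addrC subrK.
Qed.

Lemma relint_extend C x y : relint ip C x -> C y ->
  exists2 e, 0 < e & C (x + e *: (x - y)).
Proof.
move=> [Cx [e e0 ball]] Cy.
have n1 : 0 < enorm ip (x - y) + 1 by rewrite ltr_wpDl ?enorm_ge0.
exists (e / (enorm ip (x - y) + 1)); first by rewrite divr_gt0.
set t := e / _; have t0 : 0 < t by rewrite divr_gt0.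
apply: ball; last first.
  rewrite addrC addKr enormZ gtr0_norm // /t mulrAC ltr_pdivrMr //.
  by rewrite ltr_pM2l // ltrDl.
exists 2%N, (fun i => if i == ord0 then 1 + t else - t),
  (fun i => if i == ord0 then x else y).
split=> [i||]; first by case: ifP.
  by rewrite big_ord_recl big_ord1 /= addrK.
by rewrite big_ord_recl big_ord1 /= scalerBr scalerDl scale1r scaleNr addrA.
Qed.

Lemma convex_cone_convex C : convex_cone C -> @convex_set R V C.
Proof.
move=> [C0 CD CZ]; apply/convex_setP => x y t /andP[t0 t1] Cx Cy.
by apply: CD; apply: CZ; rewrite ?subr_ge0.
Qed.

Lemma is_cone_convex_cone C : @convex_set R V C -> is_cone C -> C !=set0 ->
  convex_cone C.
Proof.
move=> /convex_setP cC coneC [x0 Cx0]; split=> [|x y Cx Cy|t x]; last exact: coneC.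
  by rewrite -(scale0r x0); exact: coneC.
have -> : x + y = 2 *: (2^-1 *: x + (1 - 2^-1) *: y).
  by rewrite scalerDr !scalerA mulrBr mulr1 mulfV // addrK !scale1r.
apply: coneC => //; apply: cC => //; apply/andP; split; lra.
Qed.

(** For [t <= 1] the point [x] is the midpoint of [t x] and [(2 - t) x]; for [t > 1] it lies between
    [0] and [t x]. *)
Lemma face_scale K F x (t : R) : convex_cone K -> is_face K F -> F x ->
  0 <= t -> F (t *: x).
Proof.
move=> [K0 KD KZ] [_ FK face] Fx t0; have Kx := FK _ Fx.
have [t1|t1] := lerP t 1.
  apply: (face (t *: x) ((2 - t) *: x) _ _ _).1.
  - exact: KZ.
  - by apply: KZ => //; lra.
  exists x; split=> //; exists 2^-1; first by apply/andP; split; lra.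
  by rewrite !scalerA -scalerDl -[LHS]scale1r; congr (_ *: _); field.
have t00 : 0 < t by lra.
apply: (face 0 (t *: x) _ _ _).2 => //; first exact: KZ.
exists x; split=> //; exists t^-1.
  by rewrite invr_gt0 t00 invf_lt1.
by rewrite scaler0 add0r scalerA mulVf ?scale1r ?gt_eqF.
Qed.

Lemma face_convex_cone K F : convex_cone K -> is_face K F -> F !=set0 ->
  convex_cone F.
Proof.
move=> cK fF F0; apply: is_cone_convex_cone => //; first by case: fF.
by move=> x t t0 Fx; apply: face_scale fF Fx t0.
Qed.

Lemma face_add K F x y : convex_cone K -> is_face K F -> K x -> K y ->
  F (x + y) -> F x.
Proof.
move=> cK fF Kx Ky Fxy; have [_ _ face] := fF.
apply: (face x y Kx Ky _).1; exists (2^-1 *: (x + y)); split.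
  by exists 2^-1; [apply/andP; split; lra|rewrite scalerDr; congr (_ *: _ + _); field].
by apply: face_scale fF Fxy _.
Qed.

(** Moving the negative coefficients to the other side gives [p] in [F] with [x + p] in [F], and a
    face contains the summands in [K] of its elements. *)
Lemma face_lin_span K F x : convex_cone K -> is_face K F -> F !=set0 -> K x ->
  lin_span F x -> F x.
Proof.
move=> cK fF Fn Kx spx; have [F0 FD FZ] := face_convex_cone cK fF Fn.
have FK : F `<=` K by case: fF.
suff [p Fp Fxp] : exists2 p, F p & F (x + p) by apply: face_add (FK _ Fp) Fxp.
move: spx => [k [t [p [Fp ->]]]] {x Kx}.
elim/big_rec: _ => [|i x _ [q Fq Fxq]]; first by exists 0; rewrite ?addr0.
have [t0|t0] := lerP 0 (t i).
  by exists q => //; rewrite -addrA; apply: FD => //; apply: FZ.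
exists (q - t i *: p i); last by rewrite [_ + x]addrC addrACA subrr addr0.
by apply: FD => //; rewrite -scaleNr; apply: FZ => //; rewrite oppr_ge0 ltW.
Qed.

Definition exposed K u := [set x | K x /\ ip u x = 0].

Lemma exposed_face K u : convex_cone K -> dual_cone ip K u ->
  is_face K (exposed K u).
Proof.
move=> [K0 KD KZ] uK; split.
- apply: convex_cone_convex; split=> [|x y [Kx ux] [Ky uy]|t x t0 [Kx ux]].
  + by split=> //; rewrite ip0r.
  + by split; [exact: KD|rewrite ipDr ux uy addr0].
  + by split; [exact: KZ|rewrite ipZr ux mulr0].
- by move=> x [].
- move=> x y Kx Ky [_ [[t /andP [t0 t1] ->] [_]]].
  rewrite ipDr !ipZr => /eqP; rewrite paddr_eq0;
    rewrite ?mulr_ge0 ?subr_ge0 ?uK ?(ltW t0) ?(ltW t1) //.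
  rewrite !mulf_eq0 [1 - t == 0]gt_eqF ?subr_gt0 // [t == 0]gt_eqF //=.
  by move=> /andP [/eqP ux /eqP uy].
Qed.

(** The order ideal of [s] for the order of [K]. For [s] in a convex cone [K] it is the smallest
    face containing [s], and [s] is an order unit of it by construction. *)
Definition min_face K s := [set y | K y /\ exists2 N : R, 0 <= N & K (N *: s - y)].

Lemma min_face_face K s : convex_cone K -> is_face K (min_face K s).
Proof.
move=> [K0 KD KZ]; split.
- apply: convex_cone_convex; split.
  + by split=> //; exists 0; rewrite // scale0r subr0.
  + move=> x y [Kx [N N0 KN]] [Ky [M M0 KM]]; split; first exact: KD.
    exists (N + M); first exact: addr_ge0.
    by rewrite scalerDl opprD addrACA; apply: KD.
  + move=> t x t0 [Kx [N N0 KN]]; split; first exact: KZ.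
    by exists (t * N); [exact: mulr_ge0|rewrite -scalerA -scalerBr; exact: KZ].
- by move=> x [].
- move=> x y Kx Ky [_ [[t /andP [t0 t1] ->] [_ [N N0 KN]]]].
  have t1' : 0 < 1 - t by rewrite subr_gt0.
  split; split=> //.
    exists ((1 - t)^-1 * N); first by rewrite mulr_ge0 // invr_ge0 ltW.
    have -> : ((1 - t)^-1 * N) *: s - x = (1 - t)^-1 *:
        ((N *: s - ((1 - t) *: x + t *: y)) + t *: y).
      by rewrite opprD addrA subrK scalerBr !scalerA mulVf ?scale1r ?gt_eqF.
    by apply: (KZ); [rewrite invr_ge0 ltW|apply: KD => //; apply: KZ => //; exact: ltW].
  exists (t^-1 * N); first by rewrite mulr_ge0 // invr_ge0 ltW.
  have -> : (t^-1 * N) *: s - y = t^-1 *: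
      ((N *: s - ((1 - t) *: x + t *: y)) + (1 - t) *: x).
    by rewrite opprD addrA addrAC subrK scalerBr !scalerA mulVf ?scale1r ?gt_eqF.
  by apply: (KZ); [rewrite invr_ge0 ltW|apply: KD => //; apply: KZ => //; exact: ltW].
Qed.

Lemma min_face_order_unit K s : convex_cone K -> K s ->
  order_unit (min_face K s) s.
Proof.
move=> [K0 KD KZ] Ks; split.
  by split=> //; exists 1; rewrite // scale1r subrr.
move=> x [Kx [N N0 KN]]; exists N => //; split=> //.
by exists N => //; rewrite opprB addrC subrK.
Qed.

(** With [p] relatively interior and [N s - p] in [F], the multiple [(N + 1) s] splits as
    [p + (N s - p) + s]; the summand [p] absorbs a small displacement of [s]. *)
Lemma order_unit_relint F s : convex_cone F -> order_unit F s -> relint ip F s.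
Proof.
move=> cF [Fs dom]; have [F0 FD FZ] := cF; split=> //.
have [|p [Fp [e e0 ball]]] := relint_nonempty (convex_cone_convex cF).
  by exists 0.
have [N N0 FN] := dom _ Fp; have N1 : 0 < N + 1 by rewrite ltr_wpDl.
exists (e / (N + 1)) => [|z zF zs]; first by rewrite divr_gt0.
have [U UE] := exists_span F.
have FU x : F x -> x \in U.
  move=> Fx; apply/UE; exists 1%N, (fun=> 1), (fun=> x).
  by rewrite big_ord1 scale1r.
have zU : z \in U.
  rewrite -[z]subr0; apply: aff_hull_sub zF => // x Fx.
  by rewrite subr0 FU.
have -> : z = (N + 1)^-1 *: ((p + (N + 1) *: (z - s)) + ((N *: s - p) + s)).
  rewrite addrACA [p + _]addrCA subrr addr0 addrCA.
  have -> : N *: s + s = (N + 1) *: s by rewrite scalerDl scale1r.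
  by rewrite -scalerDr subrK scalerA mulVf ?scale1r ?gt_eqF.
apply: FZ; first by rewrite invr_ge0 ltW.
apply: (FD); last exact: FD.
apply: ball.
  apply: aff_hull_lin_span => //; apply/UE.
  by apply: rpredD; [exact: FU|apply/rpredZ/rpredB => //; exact: FU].
by rewrite addrC addKr enormZ gtr0_norm // mulrC -ltr_pdivlMr.
Qed.

Lemma relint_order_unit F s : convex_cone F -> relint ip F s -> order_unit F s.
Proof.
move=> [F0 FD FZ] rs; have Fs : F s by case: rs.
split=> // x Fx; have [e e0 Fe] := relint_extend rs Fx.
exists (e^-1 + 1); first by rewrite addr_ge0 ?invr_ge0 ?ltW.
have -> : (e^-1 + 1) *: s - x = e^-1 *: (s + e *: (s - x)).
  by rewrite scalerDr scalerA mulVf ?gt_eqF // scale1r scalerDl scale1r addrA.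
by apply: FZ; rewrite // invr_ge0 ltW.
Qed.

(** The segment from any point of [S] to a relative interior point [s] prolongs beyond [s] inside
    [S], hence inside [K]. Applied to the set of slacks, this yields the minimal face of the
    semidefinite part. *)
Lemma common_min_face K S : convex_cone K -> @convex_set R V S ->
  S !=set0 -> S `<=` K -> exists2 s, S s & S `<=` min_face K s.
Proof.
move=> [K0 KD KZ] cS S0 SK; have [s rs] := relint_nonempty cS S0.
have Ss : S s by case: rs.
exists s => // x Sx; split; first exact: SK.
have [e e0 /SK Ke] := relint_extend rs Sx.
exists (e^-1 + 1); first by rewrite addr_ge0 ?invr_ge0 ?ltW.
have -> : (e^-1 + 1) *: s - x = e^-1 *: (s + e *: (s - x)).
  by rewrite scalerDr scalerA mulVf ?gt_eqF // scale1r scalerDl scale1r addrA.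
by apply: KZ; rewrite // invr_ge0 ltW.
Qed.

Lemma bipolar_closed K : eclosed ip K -> convex_cone K ->
  dual_cone ip (dual_cone ip K) = K.
Proof.
move=> clK cK; apply/seteqP; split=> [x /(bipolar cK) /clK //|x Kx z zK].
by rewrite ipC zK.
Qed.

(* The feasible directions of K* at u form the cone K* + R u, whose dual cone is
   K cut by the hyperplane of u. *)
Lemma tan_space_dual K u : eclosed ip K -> convex_cone K -> dual_cone ip K u ->
  tan_space ip u (dual_cone ip K) = perp ip (exposed K u).
Proof.
move=> clK cK uK; set D := feasible_dir u (dual_cone ip K).
have [K0 KD KZ] := dual_cone_convex ip K.
have cD : convex_cone D.
  split=> [|x y [t t0 Kx] [s s0 Ky]|s x s0 [t t0 Kx]].
  - by exists 1; rewrite ?scaler0 ?addr0.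
  - have ts : 0 < t^-1 + s^-1 by rewrite addr_gt0 ?invr_gt0.
    (* Normalised, the weights [t^-1] and [s^-1] give [x] and [y] the same coefficient. *)
    exists (t^-1 + s^-1)^-1; first by rewrite invr_gt0.
    have -> : u + (t^-1 + s^-1)^-1 *: (x + y) = (t^-1 + s^-1)^-1 *:
        (t^-1 *: (u + t *: x) + s^-1 *: (u + s *: y)).
      rewrite !scalerDr !scalerA !mulfVK ?gt_eqF // addrACA -scalerDl.
      by rewrite -mulrDr mulVf ?gt_eqF // scale1r.
    apply: (KZ); first by rewrite invr_ge0 ltW.
    by apply: KD; apply: (KZ); rewrite // invr_ge0 ltW.
  - have [->|sn] := eqVneq s 0; first by exists 1; rewrite ?scale0r ?scaler0 ?addr0.
    exists (t / s); first by rewrite divr_gt0 // lt_def sn.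
    by rewrite scalerA divfK.
have Dexp x : exposed K u x <-> dual_cone ip D x.
  split=> [[Kx ux] y [t t0 /(_ _ Kx)]|Dx].
    by rewrite ipDl ux add0r ipZl pmulr_rge0 // ipC.
  have Kx : K x.
    rewrite -(bipolar_closed clK cK) => z zK; apply: Dx; exists 1 => //.
    by rewrite scale1r; exact: KD.
  split=> //; apply/eqP; rewrite eq_le uK // andbT -oppr_ge0 ipC -ipNr.
  apply: Dx; exists 1 => //; by rewrite scale1r subrr.
(* The closure of [D] is the dual cone of the exposed face, and the lineality space of that dual
   cone is the orthogonal complement of the face. *)
have clD y : eclosure ip D y <-> dual_cone ip (exposed K u) y.
  split=> [Dy x /Dexp Dx|Ey]; first by rewrite ipC; apply: eclosure_ge0 Dy.
  by apply: bipolar => // x /Dexp /Ey.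
apply/seteqP; split=> [y [/clD Ey /clD ENy]|y /perpE Ey].
  apply/perpE => x Ex; apply/eqP; rewrite eq_le Ey // andbT.
  by have := ENy _ Ex; rewrite ipNl oppr_ge0.
split; apply/clD => x /Ey; first by move=> ->.
by rewrite ipNl => ->; rewrite oppr0.
Qed.

End ConvexSets.

(** * Facial reduction *)

(** Index [i] stands for index [i + 1] of the extended system, the zero pair at index 0 being
    dropped, so the last pair sits at [ell]. The abstract relation [T] covers tangent spaces,
    orthogonal complements and the block constraint alike. *)
Definition ext_seq (Y : zmodType) (Kd : Y -> Prop) (T : Y -> Y -> Prop)
    (L : Y -> Prop) (ell : nat) (u v : nat -> Y) : Prop :=
  (forall i, (i <= ell)%N -> Kd (u i) /\ T (\sum_(j < i) u j) (v i)) /\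
  (forall i, (i < ell)%N -> L (u i + v i)).

Definition ext_fam (Y : zmodType) (Kd : Y -> Prop) (T : Y -> Y -> Prop)
    (L : Y -> Prop) (ell : nat) (u v : 'I_ell.+2 -> Y) : Prop :=
  [/\ u ord0 = 0 /\ v ord0 = 0,
      forall i : 'I_ell.+2, (0 < i)%N ->
        Kd (u i) /\ T (\sum_(j < ell.+2 | (j < i)%N) u j) (v i) &
      forall i : 'I_ell.+2, (0 < i <= ell)%N -> L (u i + v i)].

Section Reindexing.
Variables (Y : zmodType) (Kd : Y -> Prop) (T : Y -> Y -> Prop) (L : Y -> Prop).
Variable ell : nat.

Lemma sum_ord_shift (u : 'I_ell.+2 -> Y) k : u ord0 = 0 -> (k <= ell)%N ->
  \sum_(j < ell.+2 | (j < k.+1)%N) u j = \sum_(j < k) u (inord j.+1).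
Proof.
move=> u0 kl; pose F j := u (inord j).
rewrite (eq_bigr (fun j : 'I_ell.+2 => F j)); last first.
  by move=> j _; rewrite /F inord_val.
rewrite -(@big_ord_widen _ _ _ k.+1 ell.+2 F) ?ltnS 1?ltnW //.
rewrite big_ord_recl /F /=.
have -> : inord 0 = ord0 :> 'I_ell.+2 by apply/val_inj; rewrite /= inordK.
by rewrite u0 add0r.
Qed.

Lemma ext_fam_seq (u v : 'I_ell.+2 -> Y) : ext_fam Kd T L u v ->
  ext_seq Kd T L ell (fun i => u (inord i.+1)) (fun i => v (inord i.+1)).
Proof.
move=> [[u0 v0] uv1 uv2]; split=> i il.
  have il' : (i.+1 < ell.+2)%N by rewrite !ltnS.
  have := uv1 (inord i.+1); rewrite inordK // => /(_ isT).
  by rewrite sum_ord_shift.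
by apply: uv2; rewrite inordK ?ltnS // ltnW.
Qed.

Lemma ext_seq_fam (u v : nat -> Y) : ext_seq Kd T L ell u v ->
  ext_fam Kd T L (fun i : 'I_ell.+2 => if i == ord0 then 0 else u i.-1)
                 (fun i : 'I_ell.+2 => if i == ord0 then 0 else v i.-1).
Proof.
move=> [uv1 uv2]; split=> // [[[|i] il] // _|[[|i] il] // /andP[_ iell]].
  have il' : (i <= ell)%N by [].
  rewrite sum_ord_shift //=; have [Ku Tv] := uv1 _ il'; split=> //.
  rewrite (eq_bigr (fun j : 'I_i => u j)) // => j _.
  have jl : (j.+1 < ell.+2)%N by rewrite !ltnS (leq_trans (ltnW (ltn_ord j))).
  by rewrite -val_eqE /= inordK.
by apply: uv2.
Qed.

End Reindexing.

(** The last hypothesis, taken at [beta] equal to the supremum, yields a dual point that closes the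
    gap and attains the infimum at once. *)
Lemma strong_duality_of (R : realType) (T U : Type) (S : set T) (f : T -> R)
    (D : set U) (g : U -> R) : S !=set0 ->
  (forall x z, S x -> D z -> f x <= g z) ->
  (forall beta, (forall x, S x -> f x <= beta) -> exists2 z, D z & g z <= beta) ->
  strong_duality S f D g.
Proof.
move=> [x0 Sx0] weak strong; split.
  split=> [[beta ub]|[z Dz]].
    by have [x Sx|z Dz _] := strong beta; [apply: ub; exists x|exists z].
  by exists (g z) => _ [x Sx <-]; exact: weak.
move=> bdd _; have Sf : [set f x | x in S] !=set0 by exists (f x0), x0.
have [x Sx|z Dz gz] := strong (sup [set f x | x in S]).
  by apply: ub_le_sup => //; exists x.
have lo : ((g z)%:E <= sup_value S f)%E.
  rewrite /sup_value -(image_comp f EFin) ereal_sup_EFin ?lee_fin //.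
have weakE : (sup_value S f <= inf_value D g)%E.
  apply: ge_ereal_sup => _ [x Sx <-]; apply: le_ereal_inf_tmp => _ [z' Dz' <-].
  by rewrite lee_fin weak.
have hi : (inf_value D g <= (g z)%:E)%E by apply: ereal_inf_lbound; exists z.
have E : sup_value S f = inf_value D g.
  by apply/eqP; rewrite eq_le weakE (le_trans hi).
by split=> //; exists z => //; apply/eqP; rewrite eq_le hi andbT -E.
Qed.

Section FacialReduction.
Context {R : realType} {X Y : vectType R}.
Variables (ip : {dot Y for idfun}) (A : {linear X -> Y}) (b : Y).
Variables (K Fm : set Y) (xbar : X).
Hypothesis cK : convex_cone K.
(** Niceness enters the reduction in this form, supplied by [nice_decomposition] for a general [K]
    and by [psd_cone_nice] for matrices. *)
Hypothesis nice : forall u z, dual_cone ip K u ->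
  dual_cone ip (exposed ip K u) z ->
  exists k p, [/\ dual_cone ip K k, perp ip (exposed ip K u) p & z = k + p].
Hypothesis Fm_face : is_face K Fm.
Hypothesis Fm_unit : order_unit Fm (b - A xbar).
Hypothesis Fm_slack : forall x, K (b - A x) -> Fm (b - A x).

Definition annihilates (y : Y) := (forall x, ip y (A x) = 0) /\ ip y b = 0.

Lemma sum_dual_cone (u : nat -> Y) k : (forall i, (i < k)%N -> dual_cone ip K (u i)) ->
  dual_cone ip K (\sum_(j < k) u j).
Proof.
move=> uK x Kx; rewrite ip_suml; apply: sumr_ge0 => i _; exact: uK.
Qed.

(** Nonnegative numbers add up to zero only if both vanish. Hence the partial sums of the [u_i]
    record a decreasing sequence of faces. *)
Lemma exposedD u w : dual_cone ip K u -> dual_cone ip K w ->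
  exposed ip K (u + w) = exposed ip K u `&` [set x | ip w x = 0].
Proof.
move=> uK wK; apply/seteqP; split=> x [].
  move=> Kx /eqP; rewrite ipDl paddr_eq0 ?uK ?wK // => /andP[/eqP ? /eqP ?].
  by split.
by move=> [Kx ux] /= wx; split=> //; rewrite ipDl ux wx addr0.
Qed.

Lemma exposed_sum_sub (u : nat -> Y) m k :
  (forall i, (i < k)%N -> dual_cone ip K (u i)) -> (m <= k)%N ->
  exposed ip K (\sum_(j < k) u j) `<=` exposed ip K (\sum_(j < m) u j).
Proof.
move=> uK mk x [Kx sx]; split=> //; apply/eqP.
have rest0 : 0 <= ip (\sum_(m <= l < k) u l) x.
  by rewrite big_nat ip_suml sumr_ge0 // => l /andP [_ lk]; exact: uK.
have sm : 0 <= ip (\sum_(j < m) u j) x.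
  by apply: sum_dual_cone => // i im; apply: uK; exact: leq_trans mk.
have sE : \sum_(j < k) u j = \sum_(j < m) u j + \sum_(m <= l < k) u l.
  by rewrite -!(big_mkord xpredT u) -big_cat_nat.
by rewrite eq_le sm andbT; move: sx; rewrite sE ipDl; lra.
Qed.

Lemma annihilates_slack y : annihilates y -> ip y (b - A xbar) = 0.
Proof. by move=> [yA yb]; rewrite ipBr yA yb subr0. Qed.

(** The slack of [xbar] is annihilated by [u_i + v_i], and by [v_i] since it lies in the current
    exposed face. So [u_i] vanishes at it, hence on all of [Fm], of which it is an order unit. *)
Lemma min_face_sub_exposed k u v :
  ext_seq (dual_cone ip K) (fun U => perp ip (exposed ip K U)) annihilates k u v ->
  Fm `<=` exposed ip K (\sum_(j < k) u j).
Proof.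
move=> [uv1 uv2]; have [_ FK _] := Fm_face.
suff H i : (i <= k)%N -> Fm `<=` exposed ip K (\sum_(j < i) u j) by exact: H.
elim: i => [_ x Fx|i IHi ik]; first by rewrite big_ord0; split; [exact: FK|rewrite ip0l].
have [ui vi] := uv1 _ (ltnW ik).
have uK : dual_cone ip K (\sum_(j < i) u j).
  by apply: sum_dual_cone => j ji; apply: (uv1 j _).1; apply: ltnW (ltn_trans ji ik).
rewrite big_ord_recr exposedD // => x Fx; split; first exact: IHi (ltnW ik) _ Fx.
have us : ip (u i) (b - A xbar) = 0.
  have Fs : Fm (b - A xbar) by case: Fm_unit.
  have := annihilates_slack (uv2 _ ik); rewrite ipDl.
  by move/perpE: vi => -> ; [rewrite addr0|exact: IHi (ltnW ik) _ Fs].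
have [N N0 FN] := Fm_unit.2 _ Fx.
apply/eqP; rewrite eq_le ui ?andbT; last exact: FK.
by have := ui _ (FK _ FN); rewrite ipBr ipZr us mulr0 sub0r oppr_ge0.
Qed.

(* A relative interior point of F in the span of b and the range of A would, after
   adding a multiple of the slack of xbar, give a slack interior to F. *)
Lemma reduction_step U : dual_cone ip K U -> Fm `<=` exposed ip K U ->
  ~ (exposed ip K U `<=` Fm) ->
  exists y, [/\ dual_cone ip (exposed ip K U) y, annihilates y &
                exists2 x, exposed ip K U x & ip y x != 0].
Proof.
move=> UK FmF nF; set F := exposed ip K U in FmF nF *.
have fF : is_face K F := exposed_face cK UK.
have [_ FK _] := fF.
have AZ a x : A (a *: x) = a *: A x := linearZ_LR A a x.
have AB x z : A (x - z) = A x - A z := linearB A x z.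
have Fs : F (b - A xbar) by apply: FmF; case: Fm_unit.
have Fms : Fm (b - A xbar) by case: Fm_unit.
have F0 : F !=set0 by exists (b - A xbar).
have cF : convex_cone F := face_convex_cone cK fF F0.
have [p rp] := relint_nonempty ip (convex_cone_convex cF) F0.
have pu := relint_order_unit cF rp; have [Fp pdom] := pu.
pose W := (limg (linfun A) + <[b]>)%VS.
have AW x : A x \in W.
  have : A x \in limg (linfun A) by rewrite -[A x]lfunE memv_img ?memvf.
  by apply: subvP; exact: addvSl.
have bW : b \in W by apply: subvP (memv_line b); exact: addvSr.
have [w|y [yF yW yp]] := reducing_certificate ip (U := W) cF pu.
  move=> /memv_addP [_ /memv_imgP [x _ ->] [_ /vlineP [t ->] ->]] Fwp; apply: nF.
  rewrite lfunE in Fwp; have [_ FD FZ] := cF.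
  (* [N] makes [t + N] positive, so that [s] is a positive multiple of a slack. *)
  pose N := `|t| + 1; have N0 : 0 <= N by rewrite addr_ge0.
  have tN : 0 < t + N.
    by rewrite /N; have := ler_norm (- t); rewrite normrN; lra.
  pose s := A x + t *: b + N *: (b - A xbar).
  have sE : s = (t + N) *: (b - A ((t + N)^-1 *: (N *: xbar - x))).
    rewrite AZ AB AZ scalerBr scalerA mulfV ?gt_eqF //.
    by rewrite scale1r opprB scalerDl /s scalerBr [A x + _]addrC addrACA.
  have Fsp : F (s - p).
    by rewrite /s addrAC; apply: FD => //; apply: FZ.
  have Ksl : K (b - A ((t + N)^-1 *: (N *: xbar - x))).
    have -> : b - A ((t + N)^-1 *: (N *: xbar - x)) = (t + N)^-1 *: s.
      by rewrite sE scalerA mulVf ?scale1r ?gt_eqF.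
    case: cK => K0 KD KZ; apply: KZ; first by rewrite invr_ge0 ltW.
    by rewrite -[s](subrK p); apply: KD; exact: FK.
  have Fms' : Fm s.
    by rewrite sE; apply: (face_scale cK Fm_face); [exact: Fm_slack|exact: ltW].
  (* [Fm] contains [s], hence its summand [p], hence every element of [F] below a multiple of [p],
     which is all of [F]. *)
  have Fmp : Fm p.
    apply: (face_add cK Fm_face (FK _ Fp) (FK _ Fsp)).
    by rewrite addrC subrK.
  move=> z Fz; have [M M0 FM] := pdom _ Fz.
  apply: (face_add cK Fm_face (FK _ Fz) (FK _ FM)).
  by rewrite addrC subrK; exact: (face_scale cK Fm_face).
exists y; split=> //; last by exists p; rewrite // gt_eqF.
by split=> [x|]; exact: yW.
Qed.

Definition strict_seq k (u : nat -> Y) := forall i, (i < k)%N ->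
  ~ (exposed ip K (\sum_(j < i) u j) `<=` exposed ip K (\sum_(j < i.+1) u j)).

(** In the inductive step, every [u_i + v_i] with [i < k] vanishes on the exposed face of the sum of
    the first [k] terms, and so does [v_k]. If [u_k + v_k] were in the span of the earlier vectors,
    [u_k] would vanish there too, against strictness. The list is reversed to put the newest vector
    at its head, as [free_cons] wants. *)
Lemma strict_seq_free k u v : strict_seq k u ->
  (forall i, (i < k)%N -> dual_cone ip K (u i) /\
     perp ip (exposed ip K (\sum_(j < i) u j)) (v i)) ->
  free [seq u i + v i | i <- rev (iota 0 k)].
Proof.
elim: k => [|k IHk] strict uv; first exact: nil_free.
have -> : rev (iota 0 k.+1) = k :: rev (iota 0 k).
  by rewrite -addn1 iotaD rev_cat.
rewrite /= free_cons IHk ?andbT; last 2 first.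
- by move=> i ik; apply: strict; apply: ltnW.
- by move=> i ik; apply: uv; apply: ltnW.
have sumK i : (i <= k)%N -> dual_cone ip K (\sum_(j < i) u j).
  move=> ik; apply: sum_dual_cone => j ji; apply: (uv j _).1.
  by rewrite ltnS ltnW // (leq_trans ji).
have [uk vk] := uv k (leqnn _).
apply/negP => yspan; apply: (strict k (leqnn _)) => x Ex.
rewrite big_ord_recr /= (exposedD (sumK _ (leqnn k)) uk); split=> //=.
suff : ip (u k + v k) x = 0 by rewrite ipDl; move/perpE: vk => -> //; rewrite addr0.
set s := [seq _ | _ <- _] in yspan.
rewrite (coord_span (X := in_tuple s) yspan) ip_suml big1 // => j _.
have /mapP [i] : s`_j \in s by apply: mem_nth.
rewrite mem_rev mem_iota add0n /= => ik ->; rewrite ipZl.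
have [ui vi] := uv i (leqW ik).
have mono m : (m <= k)%N -> exposed ip K (\sum_(j < m) u j) x.
  by move=> mk; apply: exposed_sum_sub mk _ Ex => l lk; apply: (uv l _).1; exact: leqW.
have := mono i.+1 ik.
rewrite big_ord_recr /= (exposedD (sumK _ (ltnW ik)) ui) => -[Ei uix].
by rewrite ipDl uix; move/perpE: vi => -> //; rewrite addr0 mulr0.
Qed.

(** After [k] steps either [Fm] is reached, and zero pairs may be appended, or all [k] steps are
    strict. *)
Lemma exists_reducing_seq ell N d :
  (forall k u, (forall i, dual_cone ip K (u i)) -> strict_seq k u -> (k <= N)%N) ->
  (forall s, free s -> (forall y, y \in s -> annihilates y) -> (size s <= d)%N) ->
  (minn N d <= ell)%N ->
  exists u v : nat -> Y, [/\ forall i, dual_cone ip K (u i),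
    forall i, (i < ell)%N -> perp ip (exposed ip K (\sum_(j < i) u j)) (v i) /\
      annihilates (u i + v i) & exposed ip K (\sum_(j < ell) u j) `<=` Fm].
Proof.
move=> chain dimL ell_ge.
have dual0 : dual_cone ip K 0 by move=> x _; rewrite ip0l.
pose red k (u v : nat -> Y) := (forall i, dual_cone ip K (u i)) /\
  (forall i, (i < k)%N -> perp ip (exposed ip K (\sum_(j < i) u j)) (v i) /\
      annihilates (u i + v i)).
have red_sub k u v : red k u v -> Fm `<=` exposed ip K (\sum_(j < k) u j).
  move=> [uK uv].
  have : ext_seq (dual_cone ip K) (fun U => perp ip (exposed ip K U)) annihilates
      k u (fun i => if (i < k)%N then v i else 0).
    split=> i ik; last by rewrite ik; case: (uv _ ik).
    split=> //; case: ifP => [/uv [] //|_].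
    by apply/perpE => x _; rewrite ip0l.
  exact: min_face_sub_exposed.
pose upd (u : nat -> Y) k y (i : nat) := if i == k then y else u i.
have updS u k y i : (i <= k)%N -> \sum_(j < i) upd u k y j = \sum_(j < i) u j.
  move=> ik; apply: eq_bigr => j _.
  by rewrite /upd ltn_eqF // (leq_trans (ltn_ord j)).
have redS k u v y z : red k u v -> dual_cone ip K y ->
    perp ip (exposed ip K (\sum_(j < k) u j)) z -> annihilates (y + z) ->
    red k.+1 (upd u k y) (upd v k z).
  move=> [uK uv] yK zE yzL; split=> i.
    by rewrite /upd; case: ifP.
  rewrite ltnS leq_eqVlt => /orP [/eqP ->|ik]; rewrite updS ?leqnn ?(ltnW ik) //.
    by rewrite /upd eqxx.
  by rewrite /upd ltn_eqF //; exact: uv.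
have step k u v : red k u v -> strict_seq k u ->
    ~ (exposed ip K (\sum_(j < k) u j) `<=` Fm) ->
    exists u v : nat -> Y, red k.+1 u v /\ strict_seq k.+1 u.
  move=> ruv strict nF; have UK := sum_dual_cone (fun i _ => ruv.1 i) (k := k).
  have [y [yF yL [x Ex yx]]] := reduction_step UK (red_sub _ _ _ ruv) nF.
  have [w [z [wK zE yE]]] := nice UK yF.
  exists (upd u k w), (upd v k z); split.
    by apply: redS => //; rewrite -yE.
  move=> i; rewrite ltnS leq_eqVlt => /orP [/eqP ->|ik]; last first.
    by rewrite !updS ?(ltnW ik) //; exact: strict.
  rewrite big_ord_recr /= updS // /upd eqxx exposedD // => sub.
  have [_ /= wx] := sub _ Ex; case/eqP: yx.
  by rewrite yE ipDl wx; move/perpE: zE => -> //; rewrite addr0.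
have H : forall k, exists u v : nat -> Y, red k u v /\
    (exposed ip K (\sum_(j < k) u j) `<=` Fm \/ strict_seq k u).
  elim=> [|k [u [v [ruv done]]]].
    by exists (fun=> 0), (fun=> 0); do !split => //; right.
  have [sub|nsub] := pselect (exposed ip K (\sum_(j < k) u j) `<=` Fm); last first.
    case: done => // strict; have [u' [v' [ruv' strict']]] := step _ _ _ ruv strict nsub.
    by exists u', v'; split=> //; right.
  exists (upd u k 0), (upd v k 0); split.
    apply: redS => //; first by apply/perpE => x _; rewrite ip0l.
    by rewrite addr0; split=> [x|]; rewrite ip0l.
  by left; rewrite big_ord_recr /= updS // /upd eqxx addr0.
have [u [v [[uK uv] [done|strict]]]] := H ell; first by exists u, v.
have [done|nF] := pselect (exposed ip K (\sum_(j < ell) u j) `<=` Fm).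
  by exists u, v.
(* A further step would make [ell + 1] strict steps and [ell + 1] free annihilators, so [ell] would
   be less than both [N] and [d]. *)
have [u' [v' [[uK' uv'] strict']]] := step ell u v (conj uK uv) strict nF.
have lN := chain _ _ uK' strict'.
have : (size [seq (u' i + v' i)%R | i <- rev (iota 0 ell.+1)] <= d)%N.
  apply: dimL.
    by apply: strict_seq_free => // i il; split=> //; case: (uv' _ il).
  by move=> _ /mapP [i + ->]; rewrite mem_rev mem_iota => /andP [_ /uv' []].
rewrite size_map size_rev size_iota => ld.
by move: ell_ge; rewrite leqNgt leq_min lN ld.
Qed.

(** The pairs before index [ell] carry out the reduction; the last one is not tied to [L] and is the
    decomposition of [y] along the exposed face reached. Conversely, [v_ell] vanishes on [Fm], which
    lies in that face. *)
Lemma dual_min_face_seq ell N d :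
  (forall k u, (forall i, dual_cone ip K (u i)) -> strict_seq k u -> (k <= N)%N) ->
  (forall s, free s -> (forall y, y \in s -> annihilates y) -> (size s <= d)%N) ->
  (minn N d <= ell)%N ->
  forall y, dual_cone ip Fm y <-> exists u v : nat -> Y, [/\
    ext_seq (dual_cone ip K) (fun U => perp ip (exposed ip K U)) annihilates ell u v
    & y = u ell + v ell].
Proof.
move=> chain dimL ell_ge y; have [_ FK _] := Fm_face; split=> [yF|].
  have [u [v [uK uv sub]]] := exists_reducing_seq chain dimL ell_ge.
  have [|w [z [wK zE yE]]] := nice (sum_dual_cone (fun i _ => uK i) (k := ell)) (z := y).
    exact: dual_coneS yF.
  exists (fun i => if i == ell then w else u i), (fun i => if i == ell then z else v i).
  rewrite eqxx; split=> //; split=> i il; last first.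
    by rewrite ltn_eqF //; case: (uv _ il).
  have -> : \sum_(j < i) (if val j == ell then w else u j) = \sum_(j < i) u j.
    by apply: eq_bigr => j _; rewrite ltn_eqF // (leq_trans (ltn_ord j)).
  move: il; rewrite leq_eqVlt => /orP [/eqP ->|il]; first by rewrite eqxx.
  by rewrite ltn_eqF //; case: (uv _ il).
move=> [u [v [uv ->]]] x Fx; have := min_face_sub_exposed uv Fx.
have [ul vl] := uv.1 _ (leqnn ell); move/perpE: vl => vl /vl vx.
by rewrite ipDl vx addr0; apply: ul; exact: FK.
Qed.

Variable f : X -> R.
Hypothesis linf : forall a x y, f (a *: x + y) = a * f x + f y.

(** [h] is meant to send a dual feasible point to its last [u + v]. Replacing [K] by [Fm] changes no
    feasible point of the primal, so conic duality with an order unit applies. *)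
Lemma min_face_strong_duality (D : Type) (S : set D) (g : D -> R) (h : D -> Y) :
  (forall z, S z -> g z = ip b (h z)) ->
  (forall y, (exists2 z, S z & y = h z) <->
     dual_cone ip Fm y /\ forall x, ip y (A x) = f x) ->
  strong_duality [set x | K (b - A x)] f S g.
Proof.
move=> gE SE; have [_ FK _] := Fm_face.
have [Fs dom] := Fm_unit; have cF : convex_cone Fm.
  by apply: (face_convex_cone cK Fm_face); exists (b - A xbar).
apply: strong_duality_of; first by exists xbar; exact: FK.
  move=> x z Kx Sz; have [|zF zA] := (SE (h z)).1; first by exists z.
  rewrite gE // -zA [ip b _]ipC -subr_ge0 -ipBr; apply: zF; exact: Fm_slack.
move=> beta ub.
have [|y [yF yA yb]] := conic_strong_duality ip linf cF Fm_unit (beta := beta).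
  by move=> x Fx; apply: ub; exact: FK.
have [z Sz yE] := (SE y).2 (conj yF yA).
by exists z; rewrite // gE // -yE ipC.
Qed.

End FacialReduction.

(** * Nice cones *)

Section FaceChains.
Context {R : realType} {V : vectType R}.
Variable ip : {dot V for idfun}.
Implicit Types (K : set V).

(** Since [K] meets the span of a nonempty face only in that face, the spans grow strictly; their
    dimensions range from 0 to that of the space, whence the successor. *)
Lemma face_chain_bound K k G : convex_cone K -> face_chain K k G ->
  (k <= (\dim (fullv : {vspace V})).+1)%N.
Proof.
move=> cK [faces incr].
have /choice [U UE] : forall i, exists U : {vspace V},
    forall z, lin_span (G i) z <-> z \in U by move=> i; exact: exists_span.
have GU i x : G i x -> x \in U i.
  move=> Gx; apply/UE; exists 1%N, (fun=> 1), (fun=> x).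
  by rewrite big_ord1 scale1r.
have H i : (i < k)%N -> (i <= \dim (U i))%N.
  elim: i => [//|i IHi ik]; apply: leq_ltn_trans (IHi (ltnW ik)) _.
  have [sub nsub] := incr i i.+1 (leqnn _) ik.
  have UU : (U i <= U i.+1)%VS.
    apply/subvP => x /UE [n [t [p [Gp ->]]]]; apply: rpred_sum => j _.
    exact/rpredZ/GU/sub/Gp.
  rewrite ltn_neqAle dimvS // andbT; apply/negP => dimE; apply: nsub => x Gx.
  have [fG Gn] := faces i (ltnW ik); apply: (face_lin_span cK fG Gn).
    by have [[_ GK _] _] := faces _ ik; exact: GK.
  apply/UE; have := (dimv_leqif_sup UU).2; rewrite dimE => /esym UU'.
  by apply: (subvP UU'); exact: GU.
case: k faces incr H => // k _ _ /(_ k (leqnn _)) kd.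
by rewrite ltnS (leq_trans kd) // dimvS // subvf.
Qed.

Lemma longest_chain_max K k : convex_cone K -> (exists G, face_chain K k G) ->
  (k <= longest_chain K)%N.
Proof.
move=> cK Gk; pose P k := `[< exists G, face_chain K k G >].
have exP : exists k, P k by exists k; exact/asboolP.
have bound i : P i -> (i <= (\dim (fullv : {vspace V})).+1)%N.
  by move=> /asboolP [G]; exact: face_chain_bound.
rewrite /longest_chain; case: xgetP => [m _ [_]|]; first exact.
case: (ex_maxnP exP bound) => m /asboolP Pm mmax /(_ m) []; split=> // i Pi.
by apply: mmax; exact/asboolP.
Qed.

(** The [k + 1] exposed faces of the partial sums all contain [0]; listed backwards they increase.
    This is the origin of the predecessor. *)
Lemma strict_seq_longest_chain K k u : convex_cone K ->
  (forall i, dual_cone ip K (u i)) -> strict_seq ip K k u ->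
  (k <= (longest_chain K).-1)%N.
Proof.
move=> cK uK strict; suff : (k.+1 <= longest_chain K)%N.
  by case: longest_chain.
apply: longest_chain_max => //.
exists (fun i => exposed ip K (\sum_(j < k - i) u j)); split=> [i ik|i j ij jk].
  split; first by apply: exposed_face => //; exact: sum_dual_cone.
  by exists 0; case: cK => K0 _ _; split; rewrite ?ip0r.
have ji : (k - j < k - i)%N by apply: ltn_sub2l => //; exact: leq_trans ij _.
split; first by apply: exposed_sum_sub => //; exact: ltnW.
move=> sub; apply: (strict (k - j)%N); first by exact: leq_trans ji (leq_subr _ _).
by apply: subset_trans sub _; exact: exposed_sum_sub.
Qed.

(** The sum of the dual cone and the orthogonal complement being closed, the bipolar theorem reduces
    the claim to [z] being nonnegative on the dual cone of that sum. This dual cone consists of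
    points of [K] in the span of [E], hence of points of [E]. *)
Lemma nice_decomposition K u z : eclosed ip K -> convex_cone K -> is_nice ip K ->
  dual_cone ip K u -> dual_cone ip (exposed ip K u) z ->
  exists k p, [/\ dual_cone ip K k, perp ip (exposed ip K u) p & z = k + p].
Proof.
move=> clK cK niceK uK zE; have fE := exposed_face cK uK.
set E := exposed ip K u in zE fE *.
have perp0 : perp ip E 0 by apply/perpE => x _; rewrite ip0l.
have [D0 DD DZ] := dual_cone_convex ip K.
suff : minkowski_sum (dual_cone ip K) (perp ip E) z.
  by move=> [k kK [p pE <-]]; exists k, p.
apply: (niceK _ fE); apply: bipolar.
  split=> [|_ _ [k kK [p /perpE pE <-]] [k' kK' [p' /perpE pE' <-]]|
             t _ t0 [k kK [p /perpE pE <-]]].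
  - by exists 0 => //; exists 0; rewrite ?addr0.
  - exists (k + k'); first exact: DD.
    exists (p + p'); last by rewrite addrACA.
    by apply/perpE => x Ex; rewrite ipDl pE // pE' // addr0.
  - exists (t *: k); first exact: DZ.
    exists (t *: p); last by rewrite scalerDr.
    by apply/perpE => x Ex; rewrite ipZl pE // mulr0.
move=> x xC; apply: zE.
have Kx : K x.
  rewrite -(bipolar_closed clK cK) => k kK; apply: xC.
  by exists k => //; exists 0; rewrite ?addr0.
apply: (face_lin_span cK fE) => //.
  by exists 0; case: cK => K0 _ _; split; rewrite ?ip0r.
have [U UE] := exists_span E; apply/UE; apply: contraT => xU.
have [h hU hx] := orthogonal_separation ip xU.
have hE : perp ip E (- h).
  by move=> w /UE wU; rewrite ipNl hU // oppr0.
have : 0 <= ip x (- h) by apply: xC; exists 0 => //; exists (- h); rewrite ?add0r.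
by rewrite ipNr ipC hx oppr_ge0 ler10.
Qed.

End FaceChains.

Section ExtendedDual.
Context {R : realType} {X Y : vectType R}.
Variables (ipX : {dot X for idfun}) (ipY : {dot Y for idfun}).
Variables (A : {linear X -> Y}) (b : Y) (K : set Y).

Lemma adjointP y x : ipX (adjoint ipX ipY A y) x = ipY y (A x).
Proof.
have [|z zE] := riesz_representation ipX (f := fun x => ipY y (A x)).
  by move=> a x1 x2; rewrite linearP ipDr ipZr.
rewrite /adjoint; case: xgetP => [w _ wE|/(_ z) []]; first by rewrite ipC -wE ipC.
by move=> x'; rewrite ipC -zE ipC.
Qed.

Lemma adjoint_eqP y c :
  adjoint ipX ipY A y = c <-> forall x, ipY y (A x) = ipX c x.
Proof.
split=> [<- x|yc]; first by rewrite adjointP.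
apply/eqP; rewrite -subr_eq0; apply/eqP/(ip_eq0 (ip := ipX)).
set w := (X in ipX _ X); rewrite -scaleN1r ipDl ipZl adjointP yc; lra.
Qed.

(** The properties are derived for any face that [xget] may select; the smallest face of the slack
    of a relative interior point shows that there is one. *)
Lemma min_coneP : convex_cone K -> primal_feasible A b K !=set0 ->
  [/\ is_face K (min_cone ipX ipY A b K),
      exists x, order_unit (min_cone ipX ipY A b K) (b - A x) &
      forall x, K (b - A x) -> min_cone ipX ipY A b K (b - A x)].
Proof.
move=> cK feas.
have cS : @convex_set R X (primal_feasible A b K).
  apply/convex_setP => x y t t01 Kx Ky; rewrite /primal_feasible /=.
  have -> : b - A (t *: x + (1 - t) *: y) =
      t *: (b - A x) + (1 - t) *: (b - A y).
    rewrite linearD 2!linearZ /= !scalerBr addrACA -scalerDl [t + _]addrC subrK.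
    by rewrite scale1r opprD.
  by have /convex_setP := convex_cone_convex cK; apply.
rewrite /min_cone; case: xgetP => [F _ [fF [x rx rF]]|].
  have cF : convex_cone F.
    by apply: (face_convex_cone cK fF); exists (b - A x); case: rF.
  have uF := relint_order_unit cF rF; split=> //; first by exists x.
  move=> y Ky; have [e e0 Ke] := relint_extend rx Ky.
  have [K0 KD KZ] := cK; have [Fx _] := uF.
  have : F (e *: (b - A y)); last first.
    move=> /(face_scale cK fF (t := e^-1)).
    by rewrite scalerA mulVf ?gt_eqF // scale1r invr_ge0 (ltW e0); apply.
  apply: (face_add cK fF (y := b - A (x + e *: (x - y)))) => //.
    by apply: KZ => //; exact: ltW.
  (* Weighted by [e] and 1, the slacks of [y] and of the prolonged point add up to a multiple of the
     slack of [x], which lies in [F]. *)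
  have -> : e *: (b - A y) + (b - A (x + e *: (x - y))) = (1 + e) *: (b - A x).
    have AZ a x' : A (a *: x') = a *: A x' := linearZ_LR A a x'.
    have AD x' y' : A (x' + y') = A x' + A y' := linearD A x' y'.
    have AB x' y' : A (x' - y') = A x' - A y' := linearB A x' y'.
    rewrite AD AZ AB scalerDl scale1r !scalerBr !opprD opprK.
    by rewrite [b + _]addrA addrCA; congr (_ + _); rewrite addrACA addNr addr0.
  by apply: (face_scale cK fF) => //; rewrite addr_ge0 // ltW.
have [x rx] := relint_nonempty ipX cS feas.
have Kx : K (b - A x) by case: rx.
move=> /(_ (min_face K (b - A x))) []; split; first exact: min_face_face.
exists x => //; have fF := min_face_face (b - A x) cK.
have uF := min_face_order_unit cK Kx.
apply: order_unit_relint => //; apply: (face_convex_cone cK fF).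
by exists (b - A x); case: uF.
Qed.

Hypothesis clK : eclosed ipY K.
Hypothesis cK : convex_cone K.

Lemma ext_nice_seq (L : {vspace Y}) ell y :
  (forall y, y \in L <-> adjoint ipX ipY A y = 0 /\ ipY b y = 0) ->
  (exists2 uv, @ext_nice R Y ipY K L ell uv & ext_last uv = y) <->
  exists u v, [/\ ext_seq (dual_cone ipY K)
    (fun U => perp ipY (exposed ipY K U)) (annihilates ipY A b) ell u v
    & y = u ell + v ell].
Proof.
move=> LE; have LE' z : z \in L <-> annihilates ipY A b z.
  split=> [/LE [/adjoint_eqP zA zb]|[zA zb]].
    by split=> [x|]; [rewrite zA ip0l|rewrite ipC].
  by apply/LE; split; [apply/adjoint_eqP => x; rewrite zA ip0l|rewrite ipC].
have ext_seqE u v : ext_seq (dual_cone ipY K)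
    (fun U => perp ipY (exposed ipY K U)) (annihilates ipY A b) ell u v <->
    ext_seq (dual_cone ipY K)
    (fun U => tan_space ipY U (dual_cone ipY K)) (fun z => z \in L) ell u v.
  split=> -[h1 h2]; (split=> i il; last by apply/LE'; exact: h2);
    have [ui vi] := h1 i il; (have sK : dual_cone ipY K (\sum_(j < i) u j) by
      apply: sum_dual_cone => j ji; apply: (h1 j _).1; exact: leq_trans (ltnW ji) il);
    by split=> //; move: vi; rewrite tan_space_dual.
split=> [[[u v] uv <-]|[u [v [/ext_seqE uv ->]]]].
  exists (fun i => u (inord i.+1)), (fun i => v (inord i.+1)); split.
    exact/ext_seqE/ext_fam_seq.
  rewrite /ext_last /=; have -> // : inord ell.+1 = ord_max :> 'I_ell.+2.
  by apply/val_inj; rewrite /= inordK.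
exists (fun i : 'I_ell.+2 => if i == ord0 then 0 else u i.-1,
        fun i : 'I_ell.+2 => if i == ord0 then 0 else v i.-1); last by [].
have := ext_seq_fam uv; exact.
Qed.

Hypothesis niceK : is_nice ipY K.
Hypothesis feas : primal_feasible A b K !=set0.

Lemma nice_extended_dual (c : X) (L : {vspace Y}) :
  (forall y, y \in L <-> adjoint ipX ipY A y = 0 /\ ipY b y = 0) ->
  forall ell : nat, ell = minn (longest_chain K).-1%N (\dim L) ->
    dual_cone ipY (min_cone ipX ipY A b K) =
      [set ext_last uv | uv in @ext_nice R Y ipY K L ell] /\
    strong_duality
      (primal_feasible A b K) (fun x => ipX c x)
      [set uv : ext_var Y ell |
         adjoint ipX ipY A (ext_last uv) = c /\ ext_nice ipY K L uv]
      (fun uv => ipY b (ext_last uv)).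
Proof.
move=> LE ell ellE; have [fF [xbar uF] slack] := min_coneP cK feas.
have nice' u z := @nice_decomposition _ _ ipY K u z clK cK niceK.
have dualE y : dual_cone ipY (min_cone ipX ipY A b K) y <->
    exists2 uv, @ext_nice R Y ipY K L ell uv & ext_last uv = y.
  rewrite (ext_nice_seq _ _ LE).
  apply: (dual_min_face_seq cK nice' fF uF slack (N := (longest_chain K).-1)
    (d := \dim L)).
  - by move=> k u; exact: strict_seq_longest_chain.
  - move=> s fs sL; rewrite -(eqnP fs); apply: dimvS; apply/span_subvP => z /sL [zA zb].
    by apply/LE; split; [apply/adjoint_eqP => x; rewrite zA ip0l|rewrite ipC].
  - by rewrite ellE.
split; first by apply/seteqP; split=> y /dualE.
have linc a x y : ipX c (a *: x + y) = a * ipX c x + ipX c y by rewrite ipDr ipZr.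
apply: (min_face_strong_duality cK fF uF slack linc (h := @ext_last R Y ell)) => //.
move=> y; split=> [[uv [uvc uvn] ->]|[/dualE [uv uvn uvE] yc]].
  by split; [apply/dualE; exists uv|exact/adjoint_eqP].
by exists uv => //; split=> //; rewrite uvE; exact/adjoint_eqP.
Qed.

End ExtendedDual.

(** * Positive semidefinite matrices *)

Section Psd.
Context {R : realType}.

Lemma mx_ipE m n (x z : 'M[R]_(m, n)) :
  \sum_i \sum_j x i j * z i j = \tr (x *m z^T).
Proof.
apply: eq_bigr => i _; rewrite mxE; apply: eq_bigr => j _.
by rewrite mxE.
Qed.

Lemma mx11_tr (M : 'M[R]_1) : M 0 0 = \tr M.
Proof. by rewrite /mxtrace big_ord1. Qed.

Lemma tr_sqr_ge0 m n (x : 'M[R]_(m, n)) : 0 <= \tr (x *m x^T).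
Proof.
rewrite -mx_ipE; apply: sumr_ge0 => i _; apply: sumr_ge0 => j _.
by rewrite -expr2 sqr_ge0.
Qed.

Lemma tr_sqr_eq0 m n (x : 'M[R]_(m, n)) : \tr (x *m x^T) = 0 -> x = 0.
Proof.
have sq i j : 0 <= x i j * x i j by rewrite -expr2 sqr_ge0.
rewrite -mx_ipE => /eqP; rewrite psumr_eq0 => [/allP h|i _]; last exact: sumr_ge0.
apply/matrixP => i j; have := h i; rewrite mem_index_enum => /(_ isT).
rewrite psumr_eq0 // => /allP /(_ j); rewrite mem_index_enum => /(_ isT).
by rewrite -expr2 sqrf_eq0 mxE => /eqP.
Qed.

Lemma mul_trmx_eq0 m n (x : 'M[R]_(m, n)) : x^T *m x = 0 -> x = 0.
Proof.
move=> h; apply: tr_sqr_eq0; by rewrite mxtrace_mulC h mxtrace0.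
Qed.

Lemma psd0 n : psd (0 : 'M[R]_n).
Proof. by split=> [|x]; rewrite ?trmx0 // mulmx0 mul0mx mxE. Qed.

Lemma psdD n (M N : 'M[R]_n) : psd M -> psd N -> psd (M + N).
Proof.
move=> [Ms Mp] [Ns Np]; split=> [|x]; first by rewrite linearD /= Ms Ns.
by rewrite mulmxDr mulmxDl mxE addr_ge0.
Qed.

Lemma psdZ n (t : R) (M : 'M[R]_n) : 0 <= t -> psd M -> psd (t *: M).
Proof.
move=> t0 [Ms Mp]; split=> [|x]; first by rewrite linearZ /= Ms.
by rewrite -scalemxAr -scalemxAl mxE mulr_ge0.
Qed.

Lemma psd_congruence m n (M : 'M[R]_m) (B : 'M[R]_(m, n)) :
  psd M -> psd (B^T *m M *m B).
Proof.
move=> [Ms Mp]; split=> [|x]; first by rewrite !trmx_mul trmxK Ms mulmxA.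
by have := Mp (B *m x); rewrite trmx_mul !mulmxA.
Qed.

Lemma psd_gram m n (G : 'M[R]_(m, n)) : psd (G^T *m G).
Proof.
rewrite -[G^T]mulmx1; apply: psd_congruence; split=> [|x]; first exact: trmx1.
by rewrite mulmx1 mx11_tr mxtrace_mulC tr_sqr_ge0.
Qed.

(* The quadratic form is nonnegative along the line from x towards - M x. *)
Lemma psd_isotropic n (M : 'M[R]_n) (x : 'cV[R]_n) :
  psd M -> (x^T *m M *m x) 0 0 = 0 -> M *m x = 0.
Proof.
move=> [Ms Mp] qx; set y := M *m x.
have xM : x^T *m M = y^T by rewrite trmx_mul Ms.
set q := (y^T *m y) 0 0.
have q0 : 0 <= q by rewrite /q mx11_tr mxtrace_mulC tr_sqr_ge0.
set s := (y^T *m M *m y) 0 0; have s0 : 0 <= s by exact: Mp.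
have line t : 0 <= - (2 * t * q) + t ^+ 2 * s.
  have := Mp (x - t *: y).
  have -> : ((x - t *: y)^T *m M *m (x - t *: y)) 0 0 =
      (x^T *m M *m x) 0 0 - t * ((x^T *m M *m y) 0 0) - t * ((y^T *m M *m x) 0 0)
      + t * (t * s).
    have -> : (x - t *: y)^T = x^T - t *: y^T by rewrite linearB linearZ.
    rewrite mulmxBr !mulmxBl -!scalemxAl -!scalemxAr.
    rewrite /s; move: (x^T *m M *m x) (x^T *m M *m y) (y^T *m M *m x) (y^T *m M *m y).
    by move=> *; rewrite !mxE; ring.
  rewrite qx xM -[y^T *m M *m x]mulmxA -/y -/q; lra.
have q0' : q = 0.
  apply/eqP; rewrite eq_le q0 andbT leNgt; apply/negP => qp.
  (* At this [t] one has [t s < q], so the quadratic is below [- t q]; the [+ 1] covers [s = 0]. *)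
  have := line (q / (s + 1)); have s1 : 0 < s + 1 by lra.
  have e : q / (s + 1) * (s + 1) = q by rewrite divfK // gt_eqF.
  set t := q / (s + 1) in e *; have t0 : 0 < t by rewrite divr_gt0.
  nra.
by apply: mul_trmx_eq0; apply/matrixP => i j; rewrite !ord1 [RHS]mxE.
Qed.

(* Split off a rank one term M e e^T M / (e^T M e) and recurse on the rank. *)
Lemma psd_factor n (M : 'M[R]_n) : psd M ->
  exists k (G : 'M[R]_(k, n)), M = G^T *m G.
Proof.
move: {2}(\rank M) (leqnn (\rank M)) => r; elim: r M => [|r IHr] M.
  rewrite leqn0 mxrank_eq0 => /eqP -> _; exists 0%N, 0.
  by rewrite mulmx0.
move=> rM pM; have [Ms Mp] := pM.
have [[e e0]|none] := pselect (exists e : 'cV[R]_n, (e^T *m M *m e) 0 0 != 0); last first.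
  exists 0%N, 0; rewrite mulmx0; apply/matrixP => i j; rewrite mxE.
  have : M *m (delta_mx j 0 : 'cV[R]_n) = 0.
    apply: psd_isotropic => //; apply/eqP/negPn/negP => h; apply: none.
    by exists (delta_mx j 0).
  by rewrite -colE => /matrixP /(_ i 0); rewrite !mxE.
set d := (_ *m e) 0 0 in e0; have d0 : 0 < d by rewrite lt_def e0 Mp.
have eMe : e^T *m M *m e = d%:M by apply/matrixP => i j; rewrite !ord1 [RHS]mxE eqxx.
pose C := 1%:M - d^-1 *: (M *m e *m e^T).
pose M' := C *m M.
have M'E : M' = M - d^-1 *: (M *m e *m (e^T *m M)).
  by rewrite /M' mulmxBl mul1mx -scalemxAl !mulmxA.
have M'e : M' *m e = 0.
  rewrite M'E mulmxBl -scalemxAl -[_ *m (e^T *m M) *m e]mulmxA eMe.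
  by rewrite mul_mx_scalar scalerA mulVf // scale1r subrr.
(* Since [M'] kills [e], multiplying it by [C^T] on the right changes nothing, and [M'] is a
   congruence of [M]. *)
have M'C : M' = C *m M *m C^T.
  rewrite -/M' linearB /= trmx1 linearZ /= trmx_mul trmxK mulmxBr mulmx1.
  by rewrite -scalemxAr mulmxA M'e mul0mx scaler0 subr0.
have pM' : psd M' by rewrite M'C -[X in X *m M]trmxK; exact: psd_congruence.
have [|k [G M'G]] := IHr M' _ pM'.
  (* The rank drops because [e] is killed by [M'] but not by [M]. *)
  rewrite -ltnS; apply: leq_trans rM; apply: rank_ltmx; rewrite ltmxE.
  rewrite submxMl /=; apply/negP => /submxP [D MD].
  case/negP: e0; apply/eqP; have := eMe.
  rewrite -mulmxA MD -mulmxA M'e !mulmx0 => /matrixP /(_ 0 0).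
  by rewrite [LHS]mxE [RHS]mxE eqxx mulr1n => /esym.
exists (k + 1)%N, (col_mx G (Num.sqrt d^-1 *: (e^T *m M))).
have trE : (Num.sqrt d^-1 *: (e^T *m M))^T = Num.sqrt d^-1 *: (M *m e).
  by rewrite linearZ /= trmx_mul trmxK Ms.
rewrite tr_col_mx mul_row_col -M'G M'E trE.
rewrite -scalemxAl -scalemxAr scalerA -expr2 sqr_sqrtr ?invr_ge0 ?ltW //.
by rewrite subrK.
Qed.

Lemma psd_mul_eq0 n k (M : 'M[R]_n) (Y : 'M[R]_(n, k)) :
  psd M -> Y^T *m M *m Y = 0 -> M *m Y = 0.
Proof.
move=> /psd_factor [l [G ->]] h; rewrite -mulmxA [G *m Y]mul_trmx_eq0 ?mulmx0 //.
by rewrite trmx_mul !mulmxA in h *.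
Qed.

Lemma tr_mul_gram k l n (G : 'M[R]_(k, n)) (H : 'M[R]_(l, n)) :
  \tr (G^T *m G *m (H^T *m H)) = \tr ((G *m H^T)^T *m (G *m H^T)).
Proof. by rewrite trmx_mul trmxK mulmxA mxtrace_mulC !mulmxA. Qed.

Lemma tr_psd_ge0 n (M N : 'M[R]_n) : psd M -> psd N -> 0 <= \tr (M *m N).
Proof.
move=> /psd_factor [k [G ->]] /psd_factor [l [H ->]].
by rewrite tr_mul_gram mxtrace_mulC tr_sqr_ge0.
Qed.

Lemma tr_psd_eq0 n (M N : 'M[R]_n) : psd M -> psd N -> \tr (M *m N) = 0 ->
  M *m N = 0.
Proof.
move=> /psd_factor [k [G ->]] /psd_factor [l [H ->]].
rewrite tr_mul_gram mxtrace_mulC => /tr_sqr_eq0 GH.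
by rewrite mulmxA -[_ *m G *m H^T]mulmxA GH mulmx0 mul0mx.
Qed.

Lemma psdD_mul_eq0 n k (M N : 'M[R]_n) (Y : 'M[R]_(n, k)) : psd M -> psd N ->
  (M + N) *m Y = 0 -> M *m Y = 0.
Proof.
move=> pM pN h; apply: psd_mul_eq0 => //.
have [[l [G MG]] [l' [H NH]]] := (psd_factor pM, psd_factor pN).
have : \tr (Y^T *m M *m Y) + \tr (Y^T *m N *m Y) = 0.
  by rewrite -mxtraceD -mulmxDl -mulmxDr -mulmxA h mulmx0 mxtrace0.
have E (p : nat) (F : 'M[R]_(p, n)) : Y^T *m (F^T *m F) *m Y = (F *m Y)^T *m (F *m Y).
  by rewrite trmx_mul !mulmxA.
rewrite MG NH !E mxtrace_mulC [X in _ + X]mxtrace_mulC => /eqP.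
rewrite paddr_eq0 ?tr_sqr_ge0 // => /andP [/eqP /tr_sqr_eq0 -> _].
by rewrite mulmx0.
Qed.

(* Q is the orthogonal projector onto the row space of U. *)
Lemma row_projector n (U : 'M[R]_n) : exists Q Z : 'M[R]_n,
  [/\ Q^T = Q, U *m Q = U & Q = Z *m U].
Proof.
have [r [B [fB /submxP [D UD] /submxP [Z BZ]]]] : exists r (B : 'M[R]_(r, n)),
    [/\ row_free B, (U <= B)%MS & (B <= U)%MS].
  by exists (\rank U), (row_base U); rewrite row_base_free !eq_row_base.
pose S := B *m B^T.
have uS : S \in unitmx.
  rewrite -row_free_unit -kermx_eq0; apply/eqP.
  have kB : kermx S *m B = 0.
    apply: tr_sqr_eq0; rewrite trmx_mul mulmxA -[_ *m B *m B^T]mulmxA mulmx_ker.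
    by rewrite mul0mx mxtrace0.
  have /row_freeP [B' BB'] := fB.
  by rewrite -[kermx S]mulmx1 -BB' mulmxA kB mul0mx.
have Ss : S^T = S by rewrite trmx_mul trmxK.
exists (B^T *m invmx S *m B), (B^T *m invmx S *m Z); split.
- by rewrite !trmx_mul trmxK trmx_inv Ss mulmxA.
- by rewrite [X in X *m _]UD -!mulmxA (mulmxA B) (mulmxA S) mulmxV // mul1mx.
- by rewrite [X in _ *m X]BZ mulmxA.
Qed.

(** [beta] sums the absolute values of the entries; each product [x_i x_j] is at most the squared
    norm of [x]. *)
Lemma psd_diag_bound n (M : 'M[R]_n) : M^T = M -> exists beta : R, psd (beta%:M - M).
Proof.
move=> Ms; exists (\sum_i \sum_j `|M i j|); set beta := \sum_i _; split=> [|x].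
  by rewrite linearB /= tr_scalar_mx Ms.
have -> : (x^T *m (beta%:M - M) *m x) 0 0 =
    \sum_i \sum_j (`|M i j| * (\sum_k x k 0 ^+ 2) - M i j * (x i 0 * x j 0)).
  rewrite mulmxBr mulmxBl mul_mx_scalar -scalemxAl !mxE.
  under [RHS]eq_bigr do rewrite sumrB -mulr_suml.
  rewrite sumrB -mulr_suml -/beta; congr (_ * _ - _).
    by apply: eq_bigr => k _; rewrite mxE expr2.
  rewrite exchange_big /=; apply: eq_bigr => j _; rewrite mxE mulr_suml.
  by apply: eq_bigr => i _; rewrite mxE; ring.
apply: sumr_ge0 => i _; apply: sumr_ge0 => j _; rewrite subr_ge0.
have sq l : x l 0 ^+ 2 <= \sum_k x k 0 ^+ 2.
  by rewrite (bigD1 l) //= lerDl sumr_ge0 // => k _; rewrite sqr_ge0.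
apply: le_trans (ler_norm _) _; rewrite normrM ler_wpM2l //.
rewrite ler_norml; have := sq i; have := sq j.
by have := sqr_ge0 (x i 0 - x j 0); have := sqr_ge0 (x i 0 + x j 0);
  move=> *; apply/andP; split; nra.
Qed.

Lemma psd_block_diag m n (M : 'M[R]_m) (N : 'M[R]_n) : psd M -> psd N ->
  psd (block_mx M 0 0 N).
Proof.
move=> [Ms Mp] [Ns Np]; split=> [|x]; first by rewrite tr_block_mx !trmx0 Ms Ns.
rewrite -[x]vsubmxK tr_col_mx mul_row_block !mulmx0 addr0 add0r mul_row_col mxE.
by rewrite addr_ge0.
Qed.

(** By [perp_exposed_psd_cone], for psd [U] this block constraint describes the orthogonal
    complement of the face exposed by [U], that is, the tangent space at [U]. *)
Definition block_tangent n (U v : 'M[R]_n) : Prop :=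
  exists (w : 'M[R]_n) (beta : R),
    psd (block_mx U w w^T beta%:M) /\ v = w + w^T.

(** The quadratic form of the block matrix vanishes on the columns of [Y] padded with zeros, so the
    block matrix kills them and [w^T Y = 0]. *)
Lemma block_tangent_orthogonal n (U v Y : 'M[R]_n) : block_tangent U v ->
  Y^T = Y -> U *m Y = 0 -> \tr (v *m Y) = 0.
Proof.
move=> [w [beta [pB ->]]] Ys UY.
have : block_mx U w w^T beta%:M *m col_mx Y (0 : 'M_n) = 0.
  apply: psd_mul_eq0 => //; rewrite -mulmxA mul_block_col !mulmx0 !addr0 UY.
  by rewrite tr_col_mx mul_row_col trmx0 mulmx0 mul0mx addr0.
rewrite mul_block_col !mulmx0 !addr0 -[0]col_mx0 => /eq_col_mx [_ wY].
rewrite mulmxDl wY addr0 -mxtrace_tr trmx_mul Ys mxtrace_mulC wY.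
exact: mxtrace0.
Qed.

(** Let [Q] project onto the range of [U] and [P] onto its kernel. The hypothesis says [P v P = 0],
    so [v = w + w^T] for [w = Q v P + Q v Q / 2]. This [w] has the form [U X], and a Schur
    complement makes the block matrix congruent to the diagonal one with blocks [U] and
    [beta - X^T U X], psd for large [beta]. *)
Lemma block_tangentP n (U v : 'M[R]_n) : psd U -> v^T = v ->
  (forall x : 'cV[R]_n, U *m x = 0 -> (x^T *m v *m x) 0 0 = 0) ->
  block_tangent U v.
Proof.
move=> pU vs vker; have [Us _] := pU.
have [Q [Z [Qs UQ QZ]]] := row_projector U.
pose P : 'M[R]_n := 1%:M - Q.
have Ps : P^T = P by rewrite /P linearB /= trmx1 Qs.
have UP : U *m P = 0 by rewrite /P mulmxBr mulmx1 UQ subrr.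
have PvP : P *m v *m P = 0.
  have q0 (x : 'cV[R]_n) : (x^T *m (P *m v *m P) *m x) 0 0 = 0.
    have := vker (P *m x); rewrite mulmxA UP mul0mx trmx_mul Ps !mulmxA; exact.
  (* A symmetric matrix with vanishing quadratic form is psd, so [psd_isotropic] shows that it kills
     every basis vector. *)
  have pP : psd (P *m v *m P).
    by split=> [|x]; rewrite ?q0 // !trmx_mul Ps vs mulmxA.
  apply/matrixP => i j; have := psd_isotropic pP (q0 (delta_mx j 0)).
  by rewrite -colE => /matrixP /(_ i 0); rewrite !mxE.
have QU : Q = U *m Z^T by rewrite -[LHS]Qs [in LHS]QZ trmx_mul Us.
have [X XE] : exists X, U *m X = Q *m v *m P + 2^-1 *: (Q *m v *m Q).
  exists (Z^T *m (v *m P + 2^-1 *: (v *m Q))).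
  by rewrite mulmxA -QU mulmxDr -scalemxAr !mulmxA.
exists (U *m X).
have [|beta pb] := @psd_diag_bound n (X^T *m U *m X).
  by rewrite !trmx_mul trmxK Us mulmxA.
exists beta; split.
  have -> : block_mx U (U *m X) (U *m X)^T beta%:M =
      (block_mx 1%:M X 0 1%:M)^T *m
        block_mx U 0 0 (beta%:M - X^T *m U *m X) *m block_mx 1%:M X 0 1%:M.
    rewrite tr_block_mx !trmx1 trmx0 !mulmx_block !(mul1mx, mulmx1, mul0mx, mulmx0).
    by rewrite !addr0 !add0r trmx_mul Us [X in _ = block_mx _ _ _ X]addrC subrK.
  exact/psd_congruence/psd_block_diag.
have trE : (Q *m v *m P + 2^-1 *: (Q *m v *m Q))^T =
    P *m v *m Q + 2^-1 *: (Q *m v *m Q).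
  by rewrite linearD linearZ /= !trmx_mul Ps Qs vs !mulmxA.
rewrite XE trE.
have vE : v = P *m v *m P + Q *m v *m P + P *m v *m Q + Q *m v *m Q.
  have PQ : P + Q = 1%:M by rewrite /P subrK.
  by rewrite -[LHS]mulmx1 -[v in LHS]mul1mx -PQ mulmxDr !mulmxDl addrA.
rewrite [LHS]vE PvP add0r addrACA -scalerDl; congr (_ + _).
by rewrite -[LHS]scale1r; congr (_ *: _); field.
Qed.

End Psd.

(** * The cone of positive semidefinite matrices *)

Section SymmetricMatrices.
Context {R : realType} {n : nat}.

Definition symv : {vspace 'M[R]_n} := fixedSpace (linfun (@trmx R n n)).

Lemma mem_symv (M : 'M[R]_n) : reflect (M^T = M) (M \in symv).
Proof. by rewrite /symv; apply: (iffP fixedSpaceP); rewrite lfunE. Qed.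

Definition sym_ip (x y : subvs_of symv) : R := mx_ip (vsval x) (vsval y).

Lemma sym_ipE x y : sym_ip x y = \tr (vsval x *m vsval y).
Proof. by rewrite /sym_ip /mx_ip mx_ipE (mem_symv _ (subvsP y)). Qed.

Fact sym_ip_bilinear : bilinear_for *%R (idfun \; *%R) sym_ip.
Proof.
split=> u a x y; rewrite !sym_ipE.
all: have -> : vsval (a *: x + y) = a *: vsval x + vsval y by [].
  by rewrite mulmxDl -scalemxAl mxtraceD mxtraceZ.
by rewrite mulmxDr -scalemxAr mxtraceD mxtraceZ.
Qed.

HB.instance Definition _ := bilinear_isBilinear.Build R (subvs_of symv)
  (subvs_of symv) R _ _ sym_ip sym_ip_bilinear.

Fact sym_ip_sym x y : sym_ip x y = (-1) ^+ false * idfun (sym_ip y x).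
Proof. by rewrite expr0 mul1r !sym_ipE mxtrace_mulC. Qed.

HB.instance Definition _ := isHermitianSesquilinear.Build R (subvs_of symv)
  false idfun sym_ip sym_ip_sym.

Fact sym_ip_gt0 u : u != 0 -> 0 < sym_ip u u.
Proof.
move=> u0; rewrite /sym_ip /mx_ip mx_ipE lt_def tr_sqr_ge0 andbT.
by apply: contraNneq u0 => /tr_sqr_eq0 u0; apply/eqP/val_inj.
Qed.

HB.instance Definition _ := isDotProduct.Build R (subvs_of symv) sym_ip sym_ip_gt0.

Definition sym_dot : {dot (subvs_of symv) for idfun} := sym_ip.

Lemma sym_dotE x y : sym_dot x y = \tr (vsval x *m vsval y).
Proof. exact: sym_ipE. Qed.

Lemma vsprojE (M : 'M[R]_n) : M^T = M -> vsval (vsproj symv M) = M.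
Proof. by move=> /mem_symv Ms; rewrite vsprojK. Qed.

Lemma subvs_sym (y : subvs_of symv) : (vsval y)^T = vsval y.
Proof. exact/mem_symv/subvsP. Qed.

Definition psd_cone : set (subvs_of symv) := [set y | psd (vsval y)].

Lemma psd_cone_convex : convex_cone psd_cone.
Proof.
split=> [|x y|t x]; first exact: psd0.
  exact: psdD.
exact: psdZ.
Qed.

Lemma psd_sqr (x : 'cV[R]_n) : psd (x *m x^T).
Proof. by rewrite -[x in x *m _]trmxK; exact: psd_gram. Qed.

Lemma sym_dot_sqr y (x : 'cV[R]_n) :
  sym_dot y (vsproj symv (x *m x^T)) = (x^T *m vsval y *m x) 0 0.
Proof.
have [xs _] := psd_sqr x.
by rewrite sym_dotE vsprojE // mulmxA mxtrace_mulC mx11_tr mulmxA.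
Qed.

Lemma dual_psd_cone y : dual_cone sym_dot psd_cone y <-> psd (vsval y).
Proof.
split=> [yK|py z pz]; last by rewrite sym_dotE; exact: tr_psd_ge0.
split=> [|x]; first exact: subvs_sym.
have pxx := psd_sqr x.
by rewrite -sym_dot_sqr; apply: yK; rewrite /psd_cone /= vsprojE //; case: pxx.
Qed.

Lemma exposed_psd_cone u y : psd (vsval u) ->
  exposed sym_dot psd_cone u y <-> psd (vsval y) /\ vsval u *m vsval y = 0.
Proof.
move=> pu; split=> [[py]|[py uy]].
  by rewrite sym_dotE => uy; split=> //; exact: tr_psd_eq0.
by split=> //; rewrite sym_dotE uy mxtrace0.
Qed.

Lemma exposed_psd_sqr u (x : 'cV[R]_n) : psd (vsval u) -> vsval u *m x = 0 ->
  exposed sym_dot psd_cone u (vsproj symv (x *m x^T)).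
Proof.
move=> pu ux; have pxx := psd_sqr x; have [xs _] := pxx.
by apply/exposed_psd_cone => //; rewrite vsprojE // mulmxA ux mul0mx.
Qed.

(** [k] is the compression of [z] to the kernel of [u]. It is psd because [z] is nonnegative on
    [x x^T] for [x] in that kernel, and [z - k] is orthogonal to the exposed face because the
    elements [y] of the face satisfy [P y = y = y P]. *)
Lemma psd_cone_nice u z : dual_cone sym_dot psd_cone u ->
  dual_cone sym_dot (exposed sym_dot psd_cone u) z ->
  exists k p, [/\ dual_cone sym_dot psd_cone k,
    perp sym_dot (exposed sym_dot psd_cone u) p & z = k + p].
Proof.
move=> /dual_psd_cone pu zE; have [Q [Z [Qs UQ QZ]]] := row_projector (vsval u).
pose P : 'M[R]_n := 1%:M - Q.
have Ps : P^T = P by rewrite /P linearB /= trmx1 Qs.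
have UP : vsval u *m P = 0 by rewrite /P mulmxBr mulmx1 UQ subrr.
have PzPs : (P *m vsval z *m P)^T = P *m vsval z *m P.
  by rewrite !trmx_mul Ps subvs_sym mulmxA.
pose k := vsproj symv (P *m vsval z *m P).
have kE : vsval k = P *m vsval z *m P by exact: vsprojE.
exists k, (z - k); split; last by rewrite addrC subrK.
  apply/dual_psd_cone; rewrite kE; split=> // x.
  have uPx : vsval u *m (P *m x) = 0 by rewrite mulmxA UP mul0mx.
  by have := zE _ (exposed_psd_sqr pu uPx); rewrite sym_dot_sqr trmx_mul Ps !mulmxA.
apply/perpE => y /(exposed_psd_cone _ pu) [py uy].
have Qy : Q *m vsval y = 0 by rewrite QZ -mulmxA uy mulmx0.
have Py : P *m vsval y = vsval y by rewrite /P mulmxBl mul1mx Qy subr0.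
have yP : vsval y *m P = vsval y.
  by rewrite -[LHS]trmxK trmx_mul Ps subvs_sym Py subvs_sym.
rewrite sym_dotE; have -> : vsval (z - k) = vsval z - P *m vsval z *m P by rewrite -kE.
have trE : \tr (P *m vsval z *m P *m vsval y) = \tr (vsval z *m vsval y).
  by rewrite -!mulmxA Py mxtrace_mulC -mulmxA yP.
by rewrite mulmxBl mxtraceD -scaleN1r mxtraceZ trE mulN1r subrr.
Qed.

Lemma perp_exposed_psd_cone u v : psd (vsval u) ->
  perp sym_dot (exposed sym_dot psd_cone u) v <->
  block_tangent (vsval u) (vsval v).
Proof.
move=> pu; split=> [/perpE vE|uv].
  apply: block_tangentP => // [|x ux]; first exact: subvs_sym.
  by rewrite -sym_dot_sqr; apply: vE; exact: exposed_psd_sqr.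
apply/perpE => y /(exposed_psd_cone _ pu) [[ys _] uy]; rewrite sym_dotE.
exact: block_tangent_orthogonal uv ys uy.
Qed.

(* The rank of the partial sums of u grows at each strict step. *)
Lemma psd_strict_seq k u : (forall i, dual_cone sym_dot psd_cone (u i)) ->
  strict_seq sym_dot psd_cone k u -> (k <= n)%N.
Proof.
move=> uK strict; suff H i : (i <= k)%N -> (i <= \rank (vsval (\sum_(j < i) u j)%R))%N.
  by apply: leq_trans (H k (leqnn k)) (rank_leq_row _).
elim: i => [//|i IHi ik]; apply: leq_ltn_trans (IHi (ltnW ik)) _.
have pS : psd (vsval (\sum_(j < i) u j)).
  by apply/dual_psd_cone/sum_dual_cone.
have pu : psd (vsval (u i)) by exact/dual_psd_cone.
have pT : psd (vsval (\sum_(j < i.+1) u j)) by apply/dual_psd_cone/sum_dual_cone.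
have := strict i ik; set S := \sum_(j < i) u j in pS *.
set T := \sum_(j < i.+1) u j in pT *.
have TE : vsval T = vsval S + vsval (u i) by rewrite /T big_ord_recr.
move=> nsub; have [Q [Z [Qs TQ QZ]]] := row_projector (vsval T).
have SQ : vsval S *m (1%:M - Q) = 0.
  apply: (psdD_mul_eq0 pS pu); rewrite -TE mulmxBr mulmx1 TQ subrr //.
have ST : (vsval S <= vsval T)%MS.
  apply/submxP; exists (vsval S *m Z); move/eqP: SQ.
  by rewrite mulmxBr mulmx1 subr_eq0 => /eqP {1}->; rewrite [in LHS]QZ mulmxA.
rewrite ltn_neqAle mxrankS // andbT.
(* Equal ranks would put the rows of [T] in the span of those of [S]; whatever [S] kills would then
   be killed by [T], against strictness. *)
rewrite (mxrank_leqif_sup ST).2; apply/negP => /submxP [D TD].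
apply: nsub => y /(exposed_psd_cone _ pS) [py Sy].
by apply/exposed_psd_cone => //; rewrite TD -mulmxA Sy mulmx0.
Qed.

(** A symmetric matrix is determined by its entries on and above the diagonal, which are counted
    column by column. *)
Lemma dim_symv : (\dim symv <= (n * n.+1) %/ 2)%N.
Proof.
pose I := {x : 'I_n * 'I_n | (x.1 <= x.2)%N}.
pose phi (M : 'M[R]_n) : 'rV[R]_#|{: I}| :=
  \row_k M (val (enum_val k)).1 (val (enum_val k)).2.
have linphi : linear phi by move=> t x y; apply/rowP => k; rewrite !mxE.
have @g : {linear 'M[R]_n -> 'rV[R]_#|{: I}|} :=
  HB.pack phi (GRing.isLinear.Build R _ _ _ phi linphi).
have ker0 : (symv :&: lker (linfun g) = 0)%VS.
  apply/eqP; rewrite -subv0; apply/subvP => M /memv_capP [/mem_symv Ms].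
  rewrite memv_ker lfunE => /eqP gM; rewrite memv0; apply/eqP/matrixP.
  have upper (i j : 'I_n) : (i <= j)%N -> M i j = 0.
    move=> ij; pose x : I := exist (fun x : 'I_n * 'I_n => (x.1 <= x.2)%N) (i, j) ij.
    have := congr1 (fun r : 'rV_ _ => r 0 (enum_rank x)) gM.
    by rewrite /= !mxE enum_rankK.
  move=> i j; rewrite mxE; have [/upper //|ji] := leqP i j.
  by rewrite -Ms mxE upper // ltnW.
rewrite -(limg_dim_eq ker0); apply: leq_trans (dimvS (subvf _)) _.
rewrite dimvf dim_matrix mul1r card_sig -sum1_card.
rewrite -(pair_big_dep xpredT (fun i j : 'I_n => (i <= j)%N) (fun _ _ => 1%N)) /=.
rewrite (exchange_big_dep xpredT) //= (eq_bigr (fun j : 'I_n => j.+1)); last first.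
  move=> j _; rewrite sum1_card -[RHS]card_ord.
  rewrite -sum1_card (eq_bigl (fun i : 'I_n => (i < j.+1)%N)); last by [].
  by rewrite -(big_ord_widen n (fun=> 1%N)) ?ltn_ord // sum1_card card_ord.
have -> : (\sum_(j < n) j.+1 = \sum_(0 <= j < n.+1) j)%N.
  by rewrite big_mkord big_ord_recl.
by rewrite bin2_sum bin2 divn2 mulnC.
Qed.

End SymmetricMatrices.

Lemma orthogonal_free_size (R : realType) (V : vectType R)
    (ip : {dot V for idfun}) (s t : seq V) : free s -> free t ->
  (forall y z, y \in s -> z \in t -> ip y z = 0) ->
  (size s + size t <= \dim (fullv : {vspace V}))%N.
Proof.
move=> fs ft st; rewrite -(eqnP fs) -(eqnP ft) -dimv_disjoint_sum.
  exact/dimvS/subvf.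
apply/eqP; rewrite -subv0; apply/subvP => x /memv_capP [xs xt].
rewrite memv0; apply/eqP/(ip_eq0 (ip := ip)).
have sx y : y \in s -> ip y x = 0.
  move=> ys; rewrite (coord_span (X := in_tuple t) xt) ip_sumr big1 // => j _.
  by rewrite ipZr st ?mulr0 ?mem_nth.
rewrite {1}(coord_span (X := in_tuple s) xs) ip_suml big1 // => i _.
by rewrite ipZl sx ?mulr0 ?mem_nth.
Qed.

Lemma free_map_vsproj (F : fieldType) (V : vectType F) (U : {vspace V})
    (t : seq V) : {subset t <= U} -> free t -> free [seq vsproj U x | x <- t].
Proof.
move=> tU /(freeP (X := in_tuple t)) ft.
apply/(freeP (X := map_tuple (vsproj U) (in_tuple t))) => k k0 i.
apply: (ft k); rewrite -[RHS](congr1 vsval k0) linear_sum.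
apply: eq_bigr => j _; rewrite linearZ /=; congr (_ *: _).
by rewrite (nth_map 0) // vsprojK // tU // mem_nth.
Qed.

(** * The semidefinite extended dual *)

Section SemidefiniteDual.
Context {R : realType} {m n : nat}.
Variables (a : 'I_m -> 'M[R]_n) (b : 'M[R]_n).
Hypotheses (a_sym : forall i, (a i)^T = a i) (b_sym : b^T = b).

Lemma sdp_map_linear : linear (sdp_map a).
Proof.
move=> t x y; rewrite /sdp_map scaler_sumr -big_split; apply: eq_bigr => i _ /=.
by rewrite !mxE scalerDl scalerA.
Qed.

HB.instance Definition _ := GRing.isLinear.Build R _ _ _ (sdp_map a) sdp_map_linear.

Definition sdp_sym : {linear 'cV[R]_m -> subvs_of (@symv R n)} :=
  vsproj symv \o sdp_map a.

Local Notation bs := (vsproj symv b).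

Lemma val_sdp_sym x : vsval (sdp_sym x) = sdp_map a x.
Proof.
rewrite vsprojE // /sdp_map linear_sum; apply: eq_bigr => i _.
by rewrite linearZ /= a_sym.
Qed.

Lemma val_slack x : vsval (bs - sdp_sym x) = b - sdp_map a x.
Proof. by rewrite linearB /= val_sdp_sym vsprojE. Qed.

Lemma sdp_adjoint_eqP y c : sdp_adjoint a (vsval y) = c <->
  forall x, sym_dot y (sdp_sym x) = \sum_i c i 0 * x i 0.
Proof.
have E x : sym_dot y (sdp_sym x) =
    \sum_i sdp_adjoint a (vsval y) i 0 * x i 0.
  rewrite sym_dotE val_sdp_sym mulmx_sumr linear_sum; apply: eq_bigr => i _.
  rewrite -scalemxAr linearZ /= mxE /mx_ip mx_ipE subvs_sym mxtrace_mulC mulrC.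
  by [].
split=> [<- //|yc]; apply/matrixP => i j; rewrite ord1.
have := yc (delta_mx i 0); rewrite E (bigD1 i) //= big1 => [|k ki]; last first.
  by rewrite [delta_mx _ _ _ _]mxE (negPf ki) mulr0.
rewrite [X in _ = X -> _](bigD1 i) //= big1 => [|k ki]; last first.
  by rewrite [delta_mx _ _ _ _]mxE (negPf ki) mulr0.
by rewrite !addr0 [delta_mx _ _ _ _]mxE !eqxx !mulr1.
Qed.

Definition sdp_annihilates (M : 'M[R]_n) := sdp_adjoint a M = 0 /\ mx_ip b M = 0.

Lemma sdp_annihilatesE y :
  annihilates sym_dot sdp_sym bs y <-> sdp_annihilates (vsval y).
Proof.
have bE : sym_dot y bs = mx_ip b (vsval y).
  by rewrite sym_dotE vsprojE // /mx_ip mx_ipE subvs_sym mxtrace_mulC.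
have zE x : \sum_i (0 : 'cV[R]_m) i 0 * x i 0 = 0.
  by rewrite big1 // => i _; rewrite mxE mul0r.
rewrite /annihilates bE /sdp_annihilates.
split=> [[yA yb]|[/sdp_adjoint_eqP yA yb]]; split=> //; last first.
  by move=> x; rewrite yA zE.
by apply/sdp_adjoint_eqP => x; rewrite yA zE.
Qed.

(** The family is orthogonal to the independent [a_i] and to [b]. Outside their span, [b] removes
    one more dimension; inside it, orthogonality to [b] is implied, whence the two bounds. *)
Lemma annihilates_free_size (s : seq (subvs_of (@symv R n))) :
  free [tuple a i | i < m] -> free s ->
  (forall y, y \in s -> annihilates sym_dot sdp_sym bs y) ->
  (size s <= if b \notin <<[tuple a i | i < m]>>%VS
             then (n * n.+1) %/ 2 - m - 1 else (n * n.+1) %/ 2 - m)%N.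
Proof.
move=> fa fs sL.
have bound (t : seq 'M[R]_n) : free t -> (forall M, M \in t -> M^T = M) ->
    (forall y M, y \in s -> M \in t -> mx_ip M (vsval y) = 0) ->
    (size s <= (n * n.+1) %/ 2 - size t)%N.
  move=> ft tsym st.
  have ft' : free [seq vsproj symv M | M <- t].
    by apply: free_map_vsproj => // M /tsym /mem_symv.
  have := orthogonal_free_size (ip := sym_dot) fs ft'.
  rewrite size_map => sz; rewrite -(addnK (size t) (size s)); apply: leq_sub2r.
  apply: leq_trans (sz _) _.
    move=> y _ ys /mapP [M Mt ->]; rewrite sym_dotE vsprojE ?tsym //.
    by rewrite mxtrace_mulC -(st y M ys Mt) /mx_ip mx_ipE subvs_sym.
  by rewrite dimvf; exact: dim_symv.
have sa y i : y \in s -> mx_ip (a i) (vsval y) = 0.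
  move=> /sL /sdp_annihilatesE [ya _].
  by have /matrixP /(_ i 0) := ya; rewrite !mxE.
have sb y : y \in s -> mx_ip b (vsval y) = 0 by move=> /sL /sdp_annihilatesE [].
have ta M : M \in [tuple a i | i < m] -> exists i, M = a i.
  by move=> /tnthP [i ->]; exists i; rewrite tnth_mktuple.
case: ifP => [bW|_].
  have szt : size (b :: [tuple a i | i < m]) = m.+1.
    exact: (congr1 S (size_tuple _)).
  rewrite -subnDA addn1 -szt; apply: bound; first by rewrite free_cons bW.
    by move=> M; rewrite inE => /predU1P [->|/ta [i ->]].
  by move=> y M ys; rewrite inE => /predU1P [->|/ta [i ->]]; [exact: sb|exact: sa].
rewrite -[X in (_ <= _ - X)%N](size_tuple [tuple a i | i < m]).
apply: bound => // [M /ta [i ->] //|].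
by move=> y M ys /ta [i ->]; exact: sa.
Qed.

End SemidefiniteDual.

Lemma semidefinite_extended_dual (R : realType) (m n : nat) (a : 'I_m -> 'M[R]_n)
    (b : 'M[R]_n) (c : 'cV[R]_m) :
    (forall i, (a i)^T = a i) -> b^T = b ->
    free [tuple a i | i < m] ->
    sdp_primal_feasible a b !=set0 ->
    forall ell : nat,
    ell = minn n (if b \notin <<[tuple a i | i < m]>>%VS
                  then (n * n.+1) %/ 2 - m - 1
                  else (n * n.+1) %/ 2 - m)%N ->
    strong_duality
      (sdp_primal_feasible a b) (fun x => \sum_i c i 0 * x i 0)
      (@sdp_ext_feasible R m n a b c ell) (@sdp_ext_objective R n b ell).
Proof.
move=> a_sym b_sym fa feas ell ellE.
have cK := @psd_cone_convex R n.
pose A := sdp_sym a; pose bs := vsproj (@symv R n) b.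
have KE x : psd_cone (bs - A x) <-> psd (b - sdp_map a x).
  by rewrite -(val_slack a_sym b_sym x).
have primalE : sdp_primal_feasible a b = [set x | psd_cone (bs - A x)].
  by apply/seteqP; split=> x /KE.
have AZ t x : A (t *: x) = t *: A x := linearZ_LR A t x.
pose S := [set s | psd_cone s /\ exists x, s = bs - A x].
have cS : @convex_set R _ S.
  apply/convex_setP => p q t t01 [Kx [x xE]] [Ky [y yE]]; subst p q; split.
    by have /convex_setP := convex_cone_convex cK; apply.
  exists (t *: x + (1 - t) *: y); rewrite (linearD A) !AZ !scalerBr addrACA.
  by rewrite -scalerDl [t + _]addrC subrK scale1r opprD.
have [||s [Ks [xbar sE]] Smin] := common_min_face sym_dot cK cS.
- by have [x /KE Kx] := feas; exists (bs - A x); split=> //; exists x.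
- by move=> x [].
rewrite {s}sE in Ks Smin.
have fF := min_face_face (bs - A xbar) cK.
have uF := min_face_order_unit cK Ks.
have slack x : psd_cone (bs - A x) -> min_face psd_cone (bs - A xbar) (bs - A x).
  by move=> Kx; apply: Smin; split=> //; exists x.
set F := min_face _ _ in fF uF slack.
have linf t (x y : 'cV[R]_m) : \sum_i c i 0 * (t *: x + y) i 0 =
    t * (\sum_i c i 0 * x i 0) + \sum_i c i 0 * y i 0.
  rewrite mulr_sumr -big_split; apply: eq_bigr => i _ /=.
  by rewrite !mxE; ring.
have dualE := dual_min_face_seq cK (@psd_cone_nice R n) fF uF slack
  (@psd_strict_seq R n) (fun s => @annihilates_free_size R m n a b a_sym b_sym s fa)
  (eq_leq (esym ellE)).
have psd_sum (u : nat -> 'M[R]_n) i : (forall j, (j < i)%N -> psd (u j)) ->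
    psd (\sum_(j < i) u j).
  by move=> pu; elim/big_ind: _ => [|M N|j _]; [exact: psd0|exact: psdD|exact: pu].
have seqE y :
    dual_cone sym_dot F y <-> exists u v : nat -> 'M[R]_n,
    ext_seq (@psd R n) (@block_tangent R n) (sdp_annihilates a b) ell u v /\
    vsval y = u ell + v ell.
  rewrite dualE; split=> [[u [v [[uv1 uv2] ->]]]|[u [v [[uv1 uv2] yE]]]].
    exists (fun i => vsval (u i)), (fun i => vsval (v i)); split=> //.
    split=> i il; last by have /(sdp_annihilatesE a_sym b_sym) := uv2 i il.
    have [/dual_psd_cone ui vi] := uv1 i il; split=> //.
    have -> : \sum_(j < i) vsval (u j) = vsval (\sum_(j < i) u j).
      by rewrite linear_sum.
    apply/perp_exposed_psd_cone => //; apply/dual_psd_cone/sum_dual_cone => j ji.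
    by apply: (uv1 j _).1; exact: leq_trans (ltnW ji) il.
  (* To return to the space of symmetric matrices: [u_i] is symmetric as a psd matrix, [v_i] by its
     form [w + w^T]. *)
  have usym i : (i <= ell)%N -> (u i)^T = u i by move=> /uv1 [[]].
  have vsym i : (i <= ell)%N -> (v i)^T = v i.
    move=> /uv1 [_ [w [beta [_ ->]]]].
    by rewrite linearD /= trmxK addrC.
  exists (fun i => vsproj symv (u i)), (fun i => vsproj symv (v i)); split.
    split=> i il.
      have [pu tv] := uv1 i il; split.
        by apply/dual_psd_cone; rewrite vsprojE // usym.
      rewrite -linear_sum; set U := \sum_(j < i) u j.
      have pU : psd U.
        by apply: psd_sum => j ji; apply: (uv1 j _).1; exact: leq_trans (ltnW ji) il.
      have UE : vsval (vsproj symv U) = U by rewrite vsprojE //; case: pU.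
      apply/perp_exposed_psd_cone; rewrite ?UE // vsprojE // vsym //.
    apply/(sdp_annihilatesE a_sym b_sym); have il' := ltnW il.
    by rewrite linearD /= !vsprojE ?usym ?vsym //; exact: uv2.
  by apply/val_inj; rewrite /= yE !vsprojE ?usym ?vsym.
have feas_seq (z : @sdp_ext_var R n ell) : sdp_ext_feasible a b c z ->
    sdp_adjoint a (ext_u z ord_max + ext_v z ord_max) = c /\
    ext_fam (@psd R n) (@block_tangent R n) (sdp_annihilates a b) (ext_u z) (ext_v z).
  case: z => u v w beta [yc uvL uvK uv0] /=; split=> //; split=> // i i0.
  by have [ui pB vE] := uvK i i0; split=> //; exists (w i), (beta i).
have last_sym (z : @sdp_ext_var R n ell) : sdp_ext_feasible a b c z ->
    (ext_u z ord_max + ext_v z ord_max)^T = ext_u z ord_max + ext_v z ord_max.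
  move=> /feas_seq [_ [_ /(_ ord_max isT) [[us _] [w [beta [_ ->]]]] _]].
  by rewrite !linearD /= us trmxK [w^T + w]addrC.
rewrite primalE.
apply: (min_face_strong_duality (ip := sym_dot) cK fF uF slack linf
  (h := fun z => vsproj symv (ext_u z ord_max + ext_v z ord_max))).
  move=> z /last_sym zs.
  by rewrite sym_dotE !vsprojE // /sdp_ext_objective /mx_ip mx_ipE zs.
move=> y; split=> [[z zfeas ->]|[/seqE [u [v [uv yE]]] yA]].
  have [zc zfam] := feas_seq z zfeas; split.
    apply/seqE; exists (fun i => ext_u z (inord i.+1)), (fun i => ext_v z (inord i.+1)).
    split; first exact: ext_fam_seq.
    rewrite vsprojE ?last_sym //; have -> // : inord ell.+1 = ord_max :> 'I_ell.+2.
    by apply/val_inj; rewrite /= inordK.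
  by apply/(sdp_adjoint_eqP a_sym); rewrite vsprojE ?last_sym.
have [uv0 uvK uvL] := ext_seq_fam uv.
pose u' (i : 'I_ell.+2) := if i == ord0 then 0 else u i.-1.
pose v' (i : 'I_ell.+2) := if i == ord0 then 0 else v i.-1.
(* The constraints are silent at index 0, where zeros are chosen; elsewhere [block_tangent] supplies
   [w] and [beta]. *)
have /choice [wb wbE] : forall i : 'I_ell.+2, exists wb : 'M[R]_n * R, (0 < i)%N ->
    psd (block_mx (\sum_(j < ell.+2 | (j < i)%N) u' j) wb.1 wb.1^T wb.2%:M) /\
    v' i = wb.1 + wb.1^T.
  move=> i; have [i0|i0] := boolP (0 < i)%N; last by exists (0, 0).
  by have [_ [w [beta wE]]] := uvK i i0; exists (w, beta).
exists (SdpExtVar u' v' (fun i => (wb i).1) (fun i => (wb i).2)).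
  split=> // [|i i0].
    by rewrite -[RHS]((sdp_adjoint_eqP a_sym y c).2 yA) yE.
  by have [pB vE] := wbE i i0; have [ui _] := uvK i i0.
by apply/val_inj; rewrite /= -[LHS]/(vsval y) -[u' _ + _]yE vsprojE ?subvs_sym.
Qed.

Theorem corollary1 (R : realType) :
  (forall (X Y : vectType R)
      (ipX : {dot X for idfun}) (ipY : {dot Y for idfun})
      (A : {linear X -> Y}) (b : Y) (c : X) (K : set Y),
    eclosed ipY K -> @convex_set R Y K -> is_cone K -> is_nice ipY K ->
    primal_feasible A b K !=set0 ->
    forall L : {vspace Y},
    (forall y, y \in L <-> adjoint ipX ipY A y = 0 /\ ipY b y = 0) ->
    forall ell : nat, ell = minn (longest_chain K).-1%N (\dim L) ->
    dual_cone ipY (min_cone ipX ipY A b K) =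
      [set ext_last uv | uv in @ext_nice R Y ipY K L ell] /\
    strong_duality
      (primal_feasible A b K) (fun x => ipX c x)
      [set uv : ext_var Y ell |
         adjoint ipX ipY A (ext_last uv) = c /\ ext_nice ipY K L uv]
      (fun uv => ipY b (ext_last uv)))
  /\
  (forall (m n : nat) (a : 'I_m -> 'M[R]_n) (b : 'M[R]_n) (c : 'cV[R]_m),
    (forall i, (a i)^T = a i) -> b^T = b ->
    free [tuple a i | i < m] ->
    sdp_primal_feasible a b !=set0 ->
    forall ell : nat,
    ell = minn n (if b \notin <<[tuple a i | i < m]>>%VS
                  then (n * n.+1) %/ 2 - m - 1
                  else (n * n.+1) %/ 2 - m)%N ->
    strong_duality
      (sdp_primal_feasible a b) (fun x => \sum_i c i 0 * x i 0)
      (@sdp_ext_feasible R m n a b c ell) (@sdp_ext_objective R n b ell)).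
Proof.
split; last by move=> m n a b c; exact: semidefinite_extended_dual.
move=> X Y ipX ipY A b c K clK cvxK coneK niceK feas.
apply: nice_extended_dual => //; apply: is_cone_convex_cone => //.
by have [x Kx] := feas; exists (b - A x).
Qed.
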